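(* Let $0<r\le1$, $1\le p_1,p_2<\infty$, $h\in\mathbb R^n_+$, and let $A:C_{L_h}^\infty(\Omega)\to C_{L_h}^\infty(\Omega)$ be a continuous linear operator with $L_h$-symbol $\sigma_A$. If $$\sum_{\xi\in\mathbb Z^n}\|\sigma_A(\cdot,\xi)\|^r_{L^{p_2}(\Omega)}<\infty,$$ then $A$ is $r$-nuclear from $L^{p_1}(\Omega)$ to $L^{p_2}(\Omega)$ for all $1\le p_1<\infty$. Moreover, its $r$-nuclear quasi-norm satisfies $$n_r^r(A)\le C_h^r\sum_{\xi\in\mathbb Z^n}\|\sigma_A(\cdot,\xi)\|^r_{L^{p_2}(\Omega)},$$ where $C_h>0$ is a constant depending only on $h$.
   Context: Let $\Omega=(0,1)^n$ and $\mathbb R^n_+=\{h\in\mathbb R^n: h_j>0\ \forall j\}$. For $h\in\mathbb R^n_+$, $L_h$ is the Laplacian on $\Omega$ with boundary conditions $h_jf(x)|_{x_j=0}=f(x)|_{x_j=1}$, $h_j\partial_{x_j}f(x)|_{x_j=0}=\partial_{x_j}f(x)|_{x_j=1}$, $j=1,\dots,n$. With $h^x=\prod_jh_j^{x_j}$, its eigenfunctions are $u_\xi(x)=h^xe^{2\pi i\xi\cdot x}$, $\xi\in\mathbb Z^n$, with biorthogonal system $v_\xi(x)=h^{-x}e^{2\pi i\xi\cdot x}$. $C_{L_h}^\infty(\Omega)$ is the space of $f\in L^2(\Omega)$ with $\Delta^kf\in L^2(\Omega)$ satisfying the boundary conditions for all $k$. $\widehat f(\xi)=\int_\Omega f\overline{v_\xi}\,dx$;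 the $L_h$-symbol of $A$ is $\sigma_A(x,\xi)=u_\xi(x)^{-1}(Au_\xi)(x)$, so $Af(x)=\sum_\xi u_\xi(x)\sigma_A(x,\xi)\widehat f(\xi)$. A linear $T:L^{p_1}\to L^{p_2}$ is $r$-nuclear if $Tf=\sum_n\langle f,x_n'\rangle y_n$ with $x_n'\in(L^{p_1})'$, $y_n\in L^{p_2}$, $\sum_n\|x_n'\|^r\|y_n\|^r<\infty$; $n_r(T)$ is the infimum of $(\sum_n\|x_n'\|^r\|y_n\|^r)^{1/r}$ over all such representations. ''$A$ is $r$-nuclear'' means it extends to such an operator. *)

(* Defs.v *)
From HB Require Import structures.
From mathcomp Require Import all_boot all_order all_algebra.
From mathcomp Require Import all_classical all_reals all_analysis.
From mathcomp.real_closed Require Import complex.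

Set Implicit Arguments.
Unset Strict Implicit.
Unset Printing Implicit Defensive.

Import Order.TTheory GRing.Theory Num.Theory.
Import numFieldNormedType.Exports.

Local Open Scope classical_set_scope.
Local Open Scope ring_scope.
Local Open Scope complex_scope.
Notation normc := ComplexField.Normc.normc.

Section Defs.
Variables (R : realType) (n : nat).

Definition Pt := (n.-tuple R)%type.
Definition CFun := (Pt -> R[i])%type.

Definition Omega : set Pt := [set x | forall i : 'I_n, 0 < tnth x i < 1].

Definition upd (x : Pt) (j : 'I_n) (t : R) : Pt :=
  [tuple (if i == j then t else tnth x i) | i < n].

Definition pdR (j : 'I_n) (F : Pt -> R) : Pt -> R :=
  fun x => derive1 (fun t => F (upd x j t)) (tnth x j).

Definition pdC (j : 'I_n) (f : CFun) : CFun :=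
  fun x => pdR j (fun y => complex.Re (f y)) x +i* pdR j (fun y => complex.Im (f y)) x.

Definition pderivable (j : 'I_n) (f : CFun) : Prop :=
  forall x : Pt,
    derivable (fun t => complex.Re (f (upd x j t))) (tnth x j) 1 /\
    derivable (fun t => complex.Im (f (upd x j t))) (tnth x j) 1.

Definition ccontinuous (f : CFun) : Prop :=
  forall (x : Pt) (e : R), 0 < e -> exists2 d : R, 0 < d &
    forall y : Pt, (forall i, `|tnth y i - tnth x i| < d) -> normc (f y - f x) < e.

Definition iter_pd (js : seq 'I_n) (f : CFun) : CFun := foldr pdC f js.

Definition smoothC (f : CFun) : Prop :=
  forall js : seq 'I_n, ccontinuous (iter_pd js f) /\
    forall j, pderivable j (iter_pd js f).

Definition lap (f : CFun) : CFun := fun x => \sum_(j < n) pdC j (pdC j f) x.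
Definition lapk (k : nat) (f : CFun) : CFun := iter k lap f.

(* the boundary conditions defining L_h *)
Definition bc (h : n.-tuple R) (f : CFun) : Prop :=
  forall (j : 'I_n) (y : Pt), Omega y ->
    (tnth h j)%:C * f (upd y j 0) = f (upd y j 1) /\
    (tnth h j)%:C * pdC j f (upd y j 0) = pdC j f (upd y j 1).

(* C^infty_{L_h}(Omega), represented by smooth functions on R^n whose
   restriction to Omega is the element of the space *)
Definition CinfLh (h : n.-tuple R) (f : CFun) : Prop :=
  smoothC f /\ forall k, bc h (lapk k f).

Section Measure.
Variable mu : {measure set Pt -> \bar R}.

Definition is_lebesgue : Prop :=
  forall a b : Pt, (forall i, tnth a i <= tnth b i) ->
    mu [set x | forall i, tnth a i <= tnth x i <= tnth b i] =
    (\prod_(i < n) (tnth b i - tnth a i))%:E.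

Definition Lpnorm (p : R) (f : CFun) : \bar R :=
  ((\int[mu]_(x in Omega) ((normc (f x)) `^ p)%:E) `^ p^-1)%E.

Definition measC (f : CFun) : Prop :=
  measurable_fun Omega (fun x => complex.Re (f x)) /\
  measurable_fun Omega (fun x => complex.Im (f x)).

Definition inLp (p : R) (f : CFun) : Prop := measC f /\ (Lpnorm p f < +oo)%E.

Definition Lp_dual (p : R) (x' : CFun -> R[i]) : Prop :=
  (forall (a : R[i]) (f g : CFun), inLp p f -> inLp p g ->
     x' (fun x => a * f x + g x) = a * x' f + x' g) /\
  exists M : R, forall f, inLp p f -> ((normc (x' f))%:E <= M%:E * Lpnorm p f)%E.

Definition dualnorm (p : R) (x' : CFun -> R[i]) : \bar R :=
  ereal_sup [set (normc (x' f))%:E | f in [set f | inLp p f /\ (Lpnorm p f <= 1)%E]].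

(* (xs, ys) is an r-nuclear representation of (the extension of) A
   from L^{p1}(Omega) to L^{p2}(Omega):
     A f = sum_k <f, xs k> ys k   (convergence in L^{p2}) for f in C^infty_{L_h} *)
Definition nuclear_rep (h : n.-tuple R) (r p1 p2 : R) (A : CFun -> CFun)
    (xs : nat -> CFun -> R[i]) (ys : nat -> CFun) : Prop :=
  [/\ forall k, Lp_dual p1 (xs k),
      forall k, inLp p2 (ys k),
      (\sum_(k <oo) ((dualnorm p1 (xs k) * Lpnorm p2 (ys k)) `^ r) < +oo)%E &
      forall f, CinfLh h f ->
        ((fun N => Lpnorm p2 (fun x => A f x - \sum_(k < N) xs k f * ys k x))
           @ \oo --> 0%E)].

Definition r_nuclear h r p1 p2 A : Prop :=
  exists xs ys, nuclear_rep h r p1 p2 A xs ys.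

Definition nuclear_qnorm_pow h r p1 p2 A : \bar R :=
  ereal_inf [set s | exists xs ys, nuclear_rep h r p1 p2 A xs ys /\
     s = (\sum_(k <oo) ((dualnorm p1 (xs k) * Lpnorm p2 (ys k)) `^ r))%E].

(* Frechet seminorms of C^infty_{L_h}: ||Delta^k f||_{L^2(Omega)} *)
Definition cont_on_Cinf (h : n.-tuple R) (A : CFun -> CFun) : Prop :=
  forall k : nat, exists (m : nat) (C : R), 0 <= C /\
    forall f, CinfLh h f ->
      (Lpnorm 2 (lapk k (A f)) <= C%:E * \sum_(j < m.+1) Lpnorm 2 (lapk j f))%E.

End Measure.

Definition linear_on_Cinf (h : n.-tuple R) (A : CFun -> CFun) : Prop :=
  forall (a : R[i]) (f g : CFun), CinfLh h f -> CinfLh h g ->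
    forall x, Omega x -> A (fun y => a * f y + g y) x = a * A f x + A g x.

Definition expi (t : R) : R[i] := cos t +i* sin t.

(* eigenfunctions u_xi(x) = h^x e^{2 pi i xi.x} *)
Definition u_xi (h : n.-tuple R) (xi : n.-tuple int) : CFun :=
  fun x => (\prod_(j < n) (tnth h j `^ tnth x j))%:C *
           expi (2 * pi * \sum_(j < n) (tnth xi j)%:~R * tnth x j).

Definition symbol (h : n.-tuple R) (A : CFun -> CFun) (xi : n.-tuple int) : CFun :=
  fun x => (u_xi h xi x)^-1 * A (u_xi h xi) x.

End Defs.

(* Main.v *)
Require Import Defs.
From HB Require Import structures.
From mathcomp Require Import all_boot all_order all_algebra.
From mathcomp Require Import all_classical all_reals all_analysis.
From mathcomp.real_closed Require Import complex.
From mathcomp Require Import measurable_realfun.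
From mathcomp Require Import ring lra zify.

Import Order.TTheory GRing.Theory Num.Theory.
Import numFieldNormedType.Exports.

Local Open Scope classical_set_scope.
Local Open Scope ring_scope.

(* With w_xi = 1 / u_xi one has A f = sum_xi <f, w_xi> A u_xi, and |w_xi|, |u_xi|
   are bounded on the cube independently of xi; hence the functionals <., w_xi>
   have bounded norm on L^p1 and ||A u_xi||_p2 <= C ||sigma(., xi)||_p2, which
   gives the bound on the quasi-norm.  What has to be proved is that the series
   converges to A f in L^p2.  By continuity of A it suffices, for convergence in
   L^2, that Delta^j f - Delta^j S_N f tends to 0 in L^2 for each j.  The boundary
   conditions allow integration by parts, so Delta^j S_N f = S_N (Delta^j f), and
   the claim becomes the L^2 convergence of Fourier series of continuous periodic
   functions: it follows from best approximation and the uniform density of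
   trigonometric polynomials.  Since r <= 1 the series also converges absolutely
   in L^p2, and its limit there must agree with the L^2 limit.

   The measure is only known on boxes, so integrals of periodic derivatives are
   computed through Riemann sums with mean value tags, which telescope. *)

Set Implicit Arguments.
Unset Strict Implicit.
Unset Printing Implicit Defensive.

Local Open Scope complex_scope.

(** * Modulus, real part and imaginary part of complex numbers *)

Section ComplexModulus.
Variable R : realType.
Implicit Types (z w : R[i]) (x : R).

(** The functional paired with [u_xi] is integration against [w_xi = h^{-x} e^{-2 pi i xi.x}], the
    conjugate of [v_xi]. Multiplying by [h^{-x}] turns the boundary conditions into periodicity and
    the expansion into an ordinary Fourier series, so the analysis takes place on the torus. Two
    features of the hypotheses shape the proof. Periodicity is given only on the relative interior
    of the faces, and nothing relates values outside the closed cube; hence the estimates live on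
    the compact cube, and a continuity argument reaches edges and corners. Continuity of [A]
    controls L^2 norms only, whereas [p2] is arbitrary; hence L^2 smallness is carried to L^p2 by
    truncation. The constant is [4 * B * U], where [|w_xi| <= B] and [|u_xi| <= U] on the cube. Of
    the 4, one factor 2 comes from treating real and imaginary parts separately, the other from
    [t <= 1 + t^p] on a space of mass one; this takes the place of Hölder's inequality and keeps the
    constant independent of [p1]. *)

Lemma normC_normc z : `|z| = (normc z)%:C. Proof. by []. Qed.

Lemma normc_ge0 z : 0 <= normc z.
Proof. by rewrite -lecR -normC_normc normr_ge0. Qed.

Lemma normcC x : normc x%:C = `|x|.
Proof. by rewrite /= expr0n /= addr0 sqrtr_sqr. Qed.

Lemma normcR0 : normc (0 : R[i]) = 0.
Proof. by rewrite -[0]/(0%:C) normcC normr0. Qed.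

Lemma ler_normcD z w : normc (z + w) <= normc z + normc w.
Proof. by rewrite -lecR rmorphD /= -!normC_normc ler_normD. Qed.

Lemma normc_mul z w : normc (z * w) = normc z * normc w.
Proof. exact: ComplexField.Normc.normcM. Qed.

Lemma normcNE z : normc (- z) = normc z.
Proof. by apply: complexI; rewrite -!normC_normc normrN. Qed.

Lemma normc_subC z w : normc (z - w) = normc (w - z).
Proof. by rewrite -normcNE opprB. Qed.

Lemma normc_Re z : `|complex.Re z| <= normc z.
Proof. by have := normc_ge_Re z; rewrite normC_normc lecR. Qed.

Lemma normc_Im z : `|complex.Im z| <= normc z.
Proof.
case: z => a b /=; rewrite -sqrtr_sqr ler_wsqrtr//.
by rewrite lerDr sqr_ge0.
Qed.

Lemma normc_le_ReIm z : normc z <= `|complex.Re z| + `|complex.Im z|.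
Proof.
case: z => a b /=; rewrite -[X in _ <= X]ger0_norm ?addr_ge0//.
rewrite -sqrtr_sqr ler_wsqrtr// sqrrD !real_normK ?num_real//.
by rewrite addrAC lerDl mulrn_wge0 ?mulr_ge0.
Qed.

Lemma normc_sqr z : normc z ^+ 2 = complex.Re z ^+ 2 + complex.Im z ^+ 2.
Proof. by case: z => a b /=; rewrite sqr_sqrtr// addr_ge0 ?sqr_ge0. Qed.

Lemma normc_sum I (s : seq I) (P : pred I) (F : I -> R[i]) :
  normc (\sum_(i <- s | P i) F i) <= \sum_(i <- s | P i) normc (F i).
Proof.
elim/big_ind2 : _ => //; first by rewrite normcR0.
by move=> a b c d ab cd; rewrite (le_trans (ler_normcD _ _))// lerD.
Qed.

Lemma normc_prod I (s : seq I) (P : pred I) (F : I -> R[i]) :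
  normc (\prod_(i <- s | P i) F i) = \prod_(i <- s | P i) normc (F i).
Proof.
elim/big_ind2 : _ => //; first by rewrite -[1]/(1%:C) normcC normr1.
by move=> a b c d <- <-; rewrite normc_mul.
Qed.

Lemma normc_eq0 z : (normc z == 0) = (z == 0).
Proof. by apply/eqP/eqP => [/ComplexField.Normc.eq0_normc|->]//; rewrite normcR0. Qed.

Lemma ReD z w : complex.Re (z + w) = complex.Re z + complex.Re w.
Proof. by case: z w => ? ? []. Qed.

Lemma ImD z w : complex.Im (z + w) = complex.Im z + complex.Im w.
Proof. by case: z w => ? ? []. Qed.

Lemma ReN z : complex.Re (- z) = - complex.Re z.
Proof. by case: z. Qed.

Lemma ImN z : complex.Im (- z) = - complex.Im z.
Proof. by case: z. Qed.

Lemma ReM z w :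
  complex.Re (z * w) = complex.Re z * complex.Re w - complex.Im z * complex.Im w.
Proof. by case: z w => ? ? []. Qed.

Lemma ImM z w :
  complex.Im (z * w) = complex.Re z * complex.Im w + complex.Im z * complex.Re w.
Proof. by case: z w => ? ? []. Qed.

Lemma Re_sum I (s : seq I) (P : pred I) (F : I -> R[i]) :
  complex.Re (\sum_(i <- s | P i) F i) = \sum_(i <- s | P i) complex.Re (F i).
Proof. by apply: (big_morph _ ReD). Qed.

Lemma complexP z w :
  complex.Re z = complex.Re w -> complex.Im z = complex.Im w -> z = w.
Proof. by case: z w => ? ? [? ?] /= -> ->. Qed.

End ComplexModulus.

(** * Continuity on R^n and compactness of the closed cube *)

Section Continuity.
Variables (R : realType) (n : nat).
Local Notation Pt := (Pt R n).
Local Notation CFun := (CFun R n).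
Implicit Types (f g : CFun) (F G : Pt -> R) (x y : Pt).

(** Compactness of products of intervals is a statement about row vectors, while points are tuples;
    [of_rV] and [to_rV] carry continuity and compactness across. *)
Definition of_rV (v : 'rV[R]_n) : Pt := [tuple v ord0 i | i < n].
Definition to_rV (x : Pt) : 'rV[R]_n := \row_i tnth x i.

Lemma to_rVK : cancel to_rV of_rV.
Proof. by move=> x; apply: eq_from_tnth => i; rewrite tnth_mktuple mxE. Qed.

Definition rcont F := continuous (fun v => F (of_rV v)).

Lemma rcontP F : rcont F <->
  forall x e, 0 < e -> exists2 d : R, 0 < d &
    forall y, (forall i, `|tnth y i - tnth x i| < d) -> `|F y - F x| < e.
Proof.
split=> [cF x e e0|cF v].
  have := cF (to_rV x); rewrite /continuous_at to_rVK.
  move/cvgrPdist_lt/(_ e e0) => /nbhs_ballP[d /= d0 H].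
  exists d => // y yx; rewrite distrC.
  have := H (to_rV y); rewrite /= to_rVK; apply.
  by split=> // i j; rewrite !mxE /ball /= distrC.
apply/(@cvgrPdist_lt _ _ _ (nbhs v)) => e e0.
have [d d0 H] := cF (of_rV v) e e0.
apply/nbhs_ballP; exists d => //= w vw.
rewrite distrC; apply: H => i; rewrite !tnth_mktuple distrC.
exact: vw.2.
Qed.

Lemma ccontP f : ccontinuous f <->
  rcont (fun x => complex.Re (f x)) /\ rcont (fun x => complex.Im (f x)).
Proof.
split=> [cf|[/rcontP cr /rcontP ci] x e e0].
  split; apply/rcontP => x e e0; have [d d0 H] := cf x e e0; exists d => // y yx;
    apply: le_lt_trans (H y yx).
    by rewrite -ReN -ReD normc_Re.
  by rewrite -ImN -ImD normc_Im.
have e20 : 0 < e / 2 by lra.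
have [d d0 H] := cr x _ e20; have [d' d'0 H'] := ci x _ e20.
exists (Order.min d d') => [|y yx]; first by rewrite lt_min d0.
apply: le_lt_trans (normc_le_ReIm _) _; rewrite (splitr e) ReD ImD ReN ImN.
by apply: ltrD; [apply: H|apply: H'] => i; have := yx i; rewrite lt_min => /andP[].
Qed.

Lemma rcont_cst (a : R) : rcont (fun=> a).
Proof. by exact: cst_continuous. Qed.

Lemma rcontD F G : rcont F -> rcont G -> rcont (fun x => F x + G x).
Proof. by move=> cF cG v; exact: (continuousD (cF v) (cG v)). Qed.

Lemma rcontM F G : rcont F -> rcont G -> rcont (fun x => F x * G x).
Proof. by move=> cF cG v; exact: (continuousM (cF v) (cG v)). Qed.

Lemma rcontN F : rcont F -> rcont (fun x => - F x).
Proof. by move=> cF v; exact: (continuousN (cF v)). Qed.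

Lemma rcont_comp (phi : R -> R) F : continuous phi -> rcont F ->
  rcont (fun x => phi (F x)).
Proof. by move=> cphi cF v; apply: continuous_comp; [exact: cF|exact: cphi]. Qed.

Lemma rcont_tnth i : rcont (fun x => tnth x i).
Proof.
apply/rcontP => x e e0; exists e => // y; exact.
Qed.

Lemma ccont_cst (a : R[i]) : ccontinuous (fun _ : Pt => a).
Proof. by apply/ccontP; split; exact: rcont_cst. Qed.

Lemma ccontD f g : ccontinuous f -> ccontinuous g -> ccontinuous (fun x => f x + g x).
Proof.
move=> /ccontP[fr fi] /ccontP[gr gi]; apply/ccontP; split.
  by under eq_fun do rewrite ReD; exact: (rcontD fr gr).
by under eq_fun do rewrite ImD; exact: (rcontD fi gi).
Qed.

Lemma ccontM f g : ccontinuous f -> ccontinuous g -> ccontinuous (fun x => f x * g x).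
Proof.
move=> /ccontP[fr fi] /ccontP[gr gi]; apply/ccontP; split.
  by under eq_fun do rewrite ReM; exact: (rcontD (rcontM fr gr) (rcontN (rcontM fi gi))).
by under eq_fun do rewrite ImM; exact: (rcontD (rcontM fr gi) (rcontM fi gr)).
Qed.

Lemma ccontZ (a : R[i]) f : ccontinuous f -> ccontinuous (fun x => a * f x).
Proof. by move=> cf; apply: ccontM => //; exact: ccont_cst. Qed.

Lemma ccontB f g : ccontinuous f -> ccontinuous g -> ccontinuous (fun x => f x - g x).
Proof.
move=> cf cg; have := ccontD cf (ccontZ (-1) cg).
by under eq_fun do rewrite mulN1r.
Qed.

Lemma ccont_sum I (s : seq I) (P : pred I) (h : I -> CFun) :
  (forall i, ccontinuous (h i)) -> ccontinuous (fun x => \sum_(i <- s | P i) h i x).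
Proof.
move=> hc; elim: s => [|i s IH].
  by under eq_fun do rewrite big_nil; exact: ccont_cst.
under eq_fun do rewrite big_cons; case: (P i) => //; exact: ccontD.
Qed.

Lemma ccont_prod I (s : seq I) (P : pred I) (h : I -> CFun) :
  (forall i, ccontinuous (h i)) -> ccontinuous (fun x => \prod_(i <- s | P i) h i x).
Proof.
move=> hc; elim: s => [|i s IH].
  by under eq_fun do rewrite big_nil; exact: ccont_cst.
under eq_fun do rewrite big_cons; case: (P i) => //; exact: ccontM.
Qed.

Lemma ccont_real F : rcont F -> ccontinuous (fun x => (F x)%:C).
Proof. by move=> cF; apply/ccontP; split => //; exact: rcont_cst. Qed.

Lemma rcont_normc f : ccontinuous f -> rcont (fun x => normc (f x)).
Proof.
move=> cf; apply/rcontP => x e e0; have [d d0 H] := cf x e e0.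
exists d => // y /H; apply: le_lt_trans.
have h1 := ler_normcD (f y - f x) (f x); have h2 := ler_normcD (f x - f y) (f y).
rewrite (normc_subC (f x)) !subrK in h1 h2.
by rewrite ler_norml; apply/andP; split; lra.
Qed.

Definition cube : set Pt := [set x | forall i, 0 <= tnth x i <= 1].

Lemma Omega_cube x : Omega x -> cube x.
Proof. by move=> Ox i; have /andP[/ltW -> /ltW ->] := Ox i. Qed.

Definition rV_cube : set 'rV[R]_n := [set v | forall i, v ord0 i \in `[0, 1]].

Lemma compact_rV_cube : compact rV_cube.
Proof.
apply: (@rV_compact _ _ (fun=> `[(0 : R), 1]%classic)).
by move=> _; apply: segment_compact.
Qed.

Lemma rV_cubeE v : rV_cube v <-> cube (of_rV v).
Proof.
by split=> H i; have := H i; rewrite /= in_itv /= tnth_mktuple.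
Qed.

(* This one compactness statement yields uniform continuity
   ([S x y = sum_i |x_i - y_i|]), boundedness, and the Korovkin estimate on the
   torus ([S x y = sum_i (1 - cos (2 pi (x_i - y_i)))]). *)
Lemma cube_modulus f (S : Pt -> Pt -> R) :
  ccontinuous f ->
  continuous (fun p : 'rV[R]_n * 'rV[R]_n => S (of_rV p.1) (of_rV p.2)) ->
  (forall x y, 0 <= S x y) ->
  (forall x y, cube x -> cube y -> S x y = 0 -> f x = f y) ->
  forall e, 0 < e -> exists2 C : R, 0 <= C &
    forall x y, cube x -> cube y -> normc (f x - f y) <= e + C * S x y.
Proof.
move=> cf cS S0 Seq e e0.
pose D : set ('rV[R]_n * 'rV[R]_n) := rV_cube `*` rV_cube.
pose Phi (p : 'rV[R]_n * 'rV[R]_n) := normc (f (of_rV p.1) - f (of_rV p.2)).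
have cD : compact D by apply: compact_setX; exact: compact_rV_cube.
have cPhi : continuous Phi.
  move=> [v w]; apply/cvgrPdist_lt => d d0.
  have d20 : 0 < d / 2 by lra.
  have [d1 d10 H1] := cf (of_rV v) _ d20; have [d2 d20' H2] := cf (of_rV w) _ d20.
  exists (ball v d1, ball w d2) => [|[v' w'] [/= bv bw]].
    by split => /=; exact: nbhsx_ballx.
  have {}H1 : normc (f (of_rV v') - f (of_rV v)) < d / 2.
    by apply: H1 => i; rewrite !tnth_mktuple distrC; exact: (bv.2 ord0 i).
  have {}H2 : normc (f (of_rV w') - f (of_rV w)) < d / 2.
    by apply: H2 => i; rewrite !tnth_mktuple distrC; exact: (bw.2 ord0 i).
  rewrite /Phi /=; move: H1 H2.
  set a := f (of_rV v'); set b := f (of_rV v); set a' := f (of_rV w'); set b' := f (of_rV w).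
  move=> H1 H2.
  have : normc ((a - b) - (a' - b')) < d.
    rewrite (splitr d); apply: le_lt_trans (ler_normcD _ _) _.
    by rewrite normcNE ltrD.
  apply: le_lt_trans.
  have h1 := ler_normcD (a - a' - (b - b')) (b - b').
  have h2 := ler_normcD (b - b' - (a - a')) (a - a').
  rewrite (normc_subC (b - b')) !subrK in h1 h2.
  have -> : a - b - (a' - b') = a - a' - (b - b') by ring.
  by rewrite ler_norml; apply/andP; split; lra.
(* Off [K] the term [e] alone suffices. On the compact set [K] the function [S] has a positive
   minimum, since [S = 0] would force [f x = f y]. *)
pose K := D `&` [set p | e <= Phi p].
have cK : compact K.
  apply: (subclosed_compact _ cD) => [|p []//].
  apply: closedI; first by apply: compact_closed => //; exact: norm_hausdorff.
  have -> : [set p | e <= Phi p] = Phi @^-1` [set t | e <= t] by [].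
  by apply: preimage_closed => [p _|]; [exact: cPhi|exact: closed_ge].
have inK x y : cube x -> cube y -> e <= normc (f x - f y) -> K (to_rV x, to_rV y).
  by move=> cx cy exy; split=> [|/=]; [split; apply/rV_cubeE; rewrite to_rVK|rewrite /Phi /= !to_rVK].
have [K0|/set0P K0] := eqVneq K set0.
  exists 0 => // x y cx cy; rewrite mul0r addr0.
  have [|/ltW/(inK _ _ cx cy)] := leP (normc (f x - f y)) e => //.
  by rewrite K0.
have [p /set_mem pK pmin] := compact_EVT_min K0 cK (continuous_subspaceT cS).
have [q /set_mem qK qmax] := compact_EVT_max K0 cK (continuous_subspaceT cPhi).
have Sp : 0 < S (of_rV p.1) (of_rV p.2).
  rewrite lt_neqAle S0 andbT eq_sym; apply/eqP => /Seq.
  case: pK => -[/rV_cubeE p1 /rV_cubeE p2] /= ep /(_ p1 p2) fE.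
  by move: ep; rewrite /Phi fE subrr normcR0 leNgt e0.
(* The maximum of the oscillation on [K] divided by the minimum of [S] there. *)
exists (Phi q / S (of_rV p.1) (of_rV p.2)).
  by rewrite divr_ge0 ?S0 ?normc_ge0.
move=> x y cx cy.
have [le|/ltW/(inK _ _ cx cy) xyK] := leP (normc (f x - f y)) e.
  by rewrite (le_trans le)// lerDl mulr_ge0 ?divr_ge0 ?S0 ?normc_ge0.
have := qmax _ (mem_set xyK); have := pmin _ (mem_set xyK).
rewrite /Phi /= !to_rVK => Hp Hq.
apply: le_trans Hq _; rewrite -[leLHS]add0r lerD ?(ltW e0)//.
by rewrite mulrAC -mulrA ler_peMr ?normc_ge0// ler_pdivlMr// mul1r.
Qed.

Lemma continuous_sum_coord (phi : R -> R) : continuous phi ->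
  continuous (fun p : 'rV[R]_n * 'rV[R]_n =>
    \sum_i phi (tnth (of_rV p.1) i - tnth (of_rV p.2) i)).
Proof.
move=> cphi.
have -> : (fun p : 'rV[R]_n * 'rV[R]_n =>
    \sum_i phi (tnth (of_rV p.1) i - tnth (of_rV p.2) i)) =
    (fun p => \sum_i phi (p.1 ord0 i - p.2 ord0 i)).
  by apply: funext => p; apply: eq_bigr => i _; rewrite !tnth_mktuple.
elim: (index_enum _) => [|i s IH].
  by under eq_fun do rewrite big_nil; exact: cst_continuous.
under eq_fun do rewrite big_cons; move=> p.
apply: (@continuousD _ _ _ (fun p : 'rV[R]_n * 'rV[R]_n => phi _)); last exact: IH.
apply: (@continuous_comp _ _ _ (fun p : 'rV[R]_n * 'rV[R]_n => _) phi); last exact: cphi.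
apply: (@continuousB _ _ _ (fun p : 'rV[R]_n * 'rV[R]_n => p.1 ord0 i)).
  apply: (@continuous_comp _ _ _ fst (fun v : 'rV[R]_n => v ord0 i)); first exact: cvg_fst.
  exact: coord_continuous.
apply: (@continuous_comp _ _ _ snd (fun v : 'rV[R]_n => v ord0 i)); first exact: cvg_snd.
exact: coord_continuous.
Qed.

Lemma cube_unif_cont f : ccontinuous f ->
  forall e, 0 < e -> exists2 C : R, 0 <= C &
    forall x y, cube x -> cube y ->
      normc (f x - f y) <= e + C * \sum_i `|tnth x i - tnth y i|.
Proof.
move=> cf; apply: (cube_modulus cf).
- by apply: continuous_sum_coord; exact: norm_continuous.
- by move=> x y; apply: sumr_ge0.
- move=> x y _ _ /eqP; rewrite psumr_eq0// => /allP xy; congr f.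
  apply: eq_from_tnth => i; apply/eqP; rewrite -subr_eq0 -normr_eq0.
  by apply: (implyP (xy i _)) => //; rewrite mem_index_enum.
Qed.

(** The modulus estimate with [e = 1] between a point and the origin, whose coordinates differ by at
    most 1. *)
Lemma cube_bounded f : ccontinuous f ->
  exists2 C : R, 0 <= C & forall x, cube x -> normc (f x) <= C.
Proof.
move=> cf; have [C C0 H] := cube_unif_cont cf ltr01.
pose o : Pt := [tuple 0 | i < n].
have co : cube o by move=> i; rewrite tnth_mktuple lexx ler01.
exists (normc (f o) + (1 + C * n%:R)) => [|x cx].
  by rewrite addr_ge0 ?normc_ge0// addr_ge0 ?mulr_ge0.
rewrite -(subrK (f o) (f x)) (le_trans (ler_normcD _ _))// addrC lerD2l.
apply: le_trans (H _ _ cx co) _; rewrite lerD2l ler_wpM2l//.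
have -> : n%:R = \sum_(i < n) (1 : R) by rewrite sumr_const card_ord.
apply: ler_sum => i _.
by rewrite tnth_mktuple subr0; have /andP[? ?] := cx i; rewrite ger0_norm.
Qed.

End Continuity.

(** * Partial derivatives, the Laplacian and the space C^infty_{L_h} *)

Section PartialDerivatives.
Variables (R : realType) (n : nat).
Local Notation Pt := (Pt R n).
Local Notation CFun := (CFun R n).
Implicit Types (f g : CFun) (x y : Pt) (j : 'I_n).

Lemma tnth_upd x j t i : tnth (upd x j t) i = if i == j then t else tnth x i.
Proof. by rewrite tnth_mktuple. Qed.

Lemma upd_id x j : upd x j (tnth x j) = x.
Proof. by apply: eq_from_tnth => i; rewrite tnth_upd; case: eqP => // ->. Qed.

Lemma upd_upd x j t s : upd (upd x j t) j s = upd x j s.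
Proof. by apply: eq_from_tnth => i; rewrite !tnth_upd; case: eqP. Qed.

(** A relational form of [pdC], which is a total function: it carries derivability together with the
    value, so that the rules of calculus compose without side conditions. *)
Definition is_pd j f g : Prop := forall x,
  is_derive (tnth x j) 1 (fun t => complex.Re (f (upd x j t))) (complex.Re (g x)) /\
  is_derive (tnth x j) 1 (fun t => complex.Im (f (upd x j t))) (complex.Im (g x)).

Lemma pderivable_is_pd j f : pderivable j f -> is_pd j f (pdC j f).
Proof.
move=> df x; have [dr di] := df x.
by split; rewrite /pdC /pdR /= derive1E; apply: DeriveDef.
Qed.

Lemma is_pd_pderivable j f g : is_pd j f g -> pderivable j f.
Proof. by move=> fg x; have [[? ?] [? ?]] := fg x. Qed.

Lemma is_pd_pdC j f g : is_pd j f g -> pdC j f = g.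
Proof.
move=> fg; apply: funext => x; have [[_ dr] [_ di]] := fg x.
by apply: complexP; rewrite /pdC /pdR /= derive1E.
Qed.

Lemma eq_is_pd j f g f' g' : f =1 g -> f' =1 g' -> is_pd j f f' -> is_pd j g g'.
Proof. by move=> /funext -> /funext ->. Qed.

Lemma is_pd_cst j (a : R[i]) : is_pd j (fun=> a) (fun=> 0).
Proof. by move=> x; split; exact: is_derive_cst. Qed.

Lemma is_pdD j f g f' g' : is_pd j f f' -> is_pd j g g' ->
  is_pd j (fun x => f x + g x) (fun x => f' x + g' x).
Proof.
move=> ff gg x; have [? ?] := ff x; have [? ?] := gg x; split.
  by rewrite ReD; under eq_fun do rewrite ReD; exact: is_deriveD.
by rewrite ImD; under eq_fun do rewrite ImD; exact: is_deriveD.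
Qed.

Lemma is_pdM j f g f' g' : is_pd j f f' -> is_pd j g g' ->
  is_pd j (fun x => f x * g x) (fun x => f' x * g x + f x * g' x).
Proof.
move=> ff gg x; have [fr fi] := ff x; have [gr gi] := gg x.
have P := @is_deriveM R R; split.
  under eq_fun do rewrite ReM.
  have := is_deriveB (P _ _ _ _ _ _ fr gr) (P _ _ _ _ _ _ fi gi).
  by congr is_derive; rewrite ?upd_id ReD !ReM /GRing.scale /=; ring.
under eq_fun do rewrite ImM.
have := is_deriveD (P _ _ _ _ _ _ fr gi) (P _ _ _ _ _ _ fi gr).
by congr is_derive; rewrite ?upd_id ImD !ImM /GRing.scale /=; ring.
Qed.

Lemma is_pdZ j (a : R[i]) f f' : is_pd j f f' ->
  is_pd j (fun x => a * f x) (fun x => a * f' x).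
Proof.
move=> ff; apply: eq_is_pd (is_pdM (is_pd_cst j a) ff) => // x.
by rewrite mul0r add0r.
Qed.

Lemma smooth_is_pd f js j : smoothC f -> is_pd j (iter_pd js f) (pdC j (iter_pd js f)).
Proof. by move=> sf; apply: pderivable_is_pd; have [_] := sf js. Qed.

Lemma smooth_pd f j : smoothC f -> is_pd j f (pdC j f).
Proof. exact: (@smooth_is_pd f [::]). Qed.

Lemma smooth_cont f : smoothC f -> ccontinuous f.
Proof. by move=> sf; have [] := sf [::]. Qed.

Lemma smooth_pdC f j : smoothC f -> smoothC (pdC j f).
Proof.
move=> sf js; have := sf (rcons js j).
by rewrite /iter_pd foldr_rcons.
Qed.

Lemma iter_pd_lin (a : R[i]) f g js : smoothC f -> smoothC g ->
  iter_pd js (fun x => a * f x + g x) =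
  (fun x => a * iter_pd js f x + iter_pd js g x).
Proof.
move=> sf sg; elim: js => [//|j js /= ->]; apply: is_pd_pdC.
by apply: is_pdD; [apply: is_pdZ|]; exact: smooth_is_pd.
Qed.

Lemma smooth_lin (a : R[i]) f g : smoothC f -> smoothC g ->
  smoothC (fun x => a * f x + g x).
Proof.
move=> sf sg js; rewrite iter_pd_lin//; split.
  by apply: ccontD; [apply: ccontZ; have [] := sf js|have [] := sg js].
move=> j; apply: is_pd_pderivable; apply: is_pdD; [apply: is_pdZ|]; exact: smooth_is_pd.
Qed.

Lemma smooth0 : smoothC (fun _ : Pt => 0 : R[i]).
Proof.
have E js : iter_pd js (fun _ : Pt => 0 : R[i]) = (fun=> 0).
  by elim: js => [//|j js /= ->]; apply: is_pd_pdC; exact: is_pd_cst.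
move=> js; rewrite E; split; first exact: ccont_cst.
by move=> j; apply: is_pd_pderivable; exact: is_pd_cst.
Qed.

Lemma smooth_sum I (s : seq I) (f : I -> CFun) :
  (forall i, smoothC (f i)) -> smoothC (fun x => \sum_(i <- s) f i x).
Proof.
move=> sf; elim: s => [|i s IH].
  by under eq_fun do rewrite big_nil; exact: smooth0.
under eq_fun do rewrite big_cons -[f i _]mul1r; exact: smooth_lin.
Qed.

Lemma smooth_lap f : smoothC f -> smoothC (lap f).
Proof. by move=> sf; apply: smooth_sum => j; do 2 apply: smooth_pdC. Qed.

Lemma smooth_lapk f k : smoothC f -> smoothC (lapk k f).
Proof. by move=> sf; elim: k => [//|k IH]; exact: (smooth_lap IH). Qed.

Lemma pdC_lin j (a : R[i]) f g : smoothC f -> smoothC g ->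
  pdC j (fun x => a * f x + g x) = (fun x => a * pdC j f x + pdC j g x).
Proof. exact: (@iter_pd_lin a f g [:: j]). Qed.

Lemma lap_lin (a : R[i]) f g : smoothC f -> smoothC g ->
  lap (fun x => a * f x + g x) = (fun x => a * lap f x + lap g x).
Proof.
move=> sf sg; apply: funext => x; rewrite /lap mulr_sumr -big_split; apply: eq_bigr => j _.
by rewrite (pdC_lin _ _ sf sg) (pdC_lin _ _ (smooth_pdC _ sf) (smooth_pdC _ sg)).
Qed.

Lemma lapk_lin k (a : R[i]) f g : smoothC f -> smoothC g ->
  lapk k (fun x => a * f x + g x) = (fun x => a * lapk k f x + lapk k g x).
Proof.
move=> sf sg; elim: k => [//|k /= ->].
exact: lap_lin (smooth_lapk k sf) (smooth_lapk k sg).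
Qed.

Variable h : n.-tuple R.

Lemma CinfLh_lin (a : R[i]) f g : CinfLh h f -> CinfLh h g ->
  CinfLh h (fun x => a * f x + g x).
Proof.
move=> [sf bf] [sg bg]; split=> [|k]; first exact: smooth_lin.
rewrite lapk_lin// => j y Oy.
have [f0 f1] := bf k j y Oy; have [g0 g1] := bg k j y Oy.
rewrite pdC_lin; [|exact: smooth_lapk..].
by rewrite !mulrDr !(mulrCA _ a) f0 f1 g0 g1.
Qed.

Lemma lapk0 k : lapk k (fun _ : Pt => 0 : R[i]) = (fun=> 0).
Proof.
elim: k => [//|k /= ->]; apply: funext => x; rewrite /lap big1// => j _.
by rewrite !(is_pd_pdC (is_pd_cst j 0)).
Qed.

Lemma CinfLh0 : CinfLh h (fun=> 0).
Proof.
split=> [|k]; first exact: smooth0.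
by rewrite lapk0 => j y _; rewrite !(is_pd_pdC (is_pd_cst j 0)) mulr0.
Qed.

Lemma CinfLh_lapk f k : CinfLh h f -> CinfLh h (lapk k f).
Proof.
move=> [sf bf]; split=> [|l]; first exact: smooth_lapk.
by rewrite /lapk -iterD; exact: bf.
Qed.

Lemma CinfLh_sum I (s : seq I) (c : I -> R[i]) (f : I -> CFun) :
  (forall i, CinfLh h (f i)) -> CinfLh h (fun x => \sum_(i <- s) c i * f i x).
Proof.
move=> cf; elim: s => [|i s IH].
  by under eq_fun do rewrite big_nil; exact: CinfLh0.
by under eq_fun do rewrite big_cons; exact: CinfLh_lin.
Qed.

Lemma lapk_sum I (s : seq I) (c : I -> R[i]) (f : I -> CFun) k :
  (forall i, smoothC (f i)) ->
  lapk k (fun x => \sum_(i <- s) c i * f i x) =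
  (fun x => \sum_(i <- s) c i * lapk k (f i) x).
Proof.
move=> sf; elim: s => [|i s IH].
  under eq_fun do rewrite big_nil; under [RHS]eq_fun do rewrite big_nil.
  exact: lapk0.
under eq_fun do rewrite big_cons; under [RHS]eq_fun do rewrite big_cons.
rewrite lapk_lin// ?IH//; apply: smooth_sum => l.
have := smooth_lin (c l) (sf l) smooth0.
by under eq_fun do rewrite addr0.
Qed.

End PartialDerivatives.

(** * Complex exponentials as joint eigenfunctions of the partial derivatives *)

Section Exponentials.
Variables (R : realType).

(** This is e^{ct} for complex [c] and real [t]. *)
Definition cexp (c : R[i]) (t : R) : R[i] :=
  (expR (complex.Re c * t))%:C * expi (complex.Im c * t).

Lemma expiD (s t : R) : expi (s + t) = expi s * expi t.
Proof.
by apply: complexP; rewrite ?ReM ?ImM /= ?cosD ?sinD //; ring.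
Qed.

Lemma expi0 : expi (0 : R) = 1.
Proof. by rewrite /expi cos0 sin0. Qed.

Lemma normc_expi (t : R) : normc (expi t) = 1.
Proof. by rewrite /= cos2Dsin2 sqrtr1. Qed.

Lemma cexpDl (c d : R[i]) t : cexp (c + d) t = cexp c t * cexp d t.
Proof. by rewrite /cexp ReD ImD !mulrDl expRD expiD rmorphM /=; ring. Qed.

Lemma cexp0 (t : R) : cexp 0 t = 1.
Proof. by rewrite /cexp /= !mul0r expR0 expi0 mulr1. Qed.

Lemma cexpC0 (c : R[i]) : cexp c 0 = 1.
Proof. by rewrite /cexp !mulr0 expR0 expi0 mulr1. Qed.

Lemma normc_cexp (c : R[i]) t : normc (cexp c t) = expR (complex.Re c * t).
Proof. by rewrite /cexp normc_mul normcC normc_expi mulr1 ger0_norm// expR_ge0. Qed.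

Lemma cexpE (c : R[i]) t : cexp c t =
  expR (complex.Re c * t) * cos (complex.Im c * t) +i*
  (expR (complex.Re c * t) * sin (complex.Im c * t)).
Proof. by apply: complexP; rewrite ?ReM ?ImM /=; ring. Qed.

Lemma is_derive_cexp (c : R[i]) (t : R) :
  is_derive t 1 (fun s => complex.Re (cexp c s)) (complex.Re (c * cexp c t)) /\
  is_derive t 1 (fun s => complex.Im (cexp c s)) (complex.Im (c * cexp c t)).
Proof.
have L (a : R) : is_derive t 1 (fun s : R => a * s) a.
  have := @is_deriveZ R R R id a t 1 1 (is_derive_id t 1).
  by rewrite /GRing.scale /= mulr1.
have dexp := is_derive1_comp (is_derive_expR (complex.Re c * t)) (L (complex.Re c)).
have dcos := is_derive1_comp (is_derive_cos (complex.Im c * t)) (L (complex.Im c)).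
have dsin := is_derive1_comp (is_derive_sin (complex.Im c * t)) (L (complex.Im c)).
have P := @is_deriveM R R; split.
  under eq_fun do rewrite cexpE.
  have := P _ _ _ _ _ _ dexp dcos.
  by congr is_derive; rewrite ReM cexpE /GRing.scale /=; ring.
under eq_fun do rewrite cexpE.
have := P _ _ _ _ _ _ dexp dsin.
by congr is_derive; rewrite ImM cexpE /GRing.scale /=; ring.
Qed.

Lemma continuous_cexp (c : R[i]) :
  continuous (fun s => complex.Re (cexp c s)) /\
  continuous (fun s => complex.Im (cexp c s)).
Proof.
by split=> t; have [[d1 _] [d2 _]] := is_derive_cexp c t;
  apply: (@differentiable_continuous R R R); apply/derivable1_diffP.
Qed.

Variable n : nat.
Local Notation Pt := (Pt R n).
Implicit Types (c d : 'I_n -> R[i]) (x y : Pt) (j : 'I_n).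

(** This is e^{c.x}. Complex exponents let one family cover the characters of the torus, the weights
    [h^x] and [h^{-x}], the eigenfunctions and their inverses. *)
Definition Exp c : CFun R n := fun x => \prod_j cexp (c j) (tnth x j).

Lemma ExpD c d x : Exp (fun j => c j + d j) x = Exp c x * Exp d x.
Proof. by rewrite /Exp -big_split; apply: eq_bigr => j _; rewrite cexpDl. Qed.

Lemma Exp0 x : Exp (fun=> 0) x = 1.
Proof. by rewrite /Exp big1// => j _; rewrite cexp0. Qed.

(** At [t = 1] this compares opposite faces: the ratio of the two values is [cexp (c j) 1], which is
    [h_j] for [u_xi] and 1 for a character. *)
Lemma Exp_upd c x j t : Exp c (upd x j t) = cexp (c j) t * Exp c (upd x j 0).
Proof.
rewrite /Exp (bigD1 j)//= [in RHS](bigD1 j)//= !tnth_upd !eqxx cexpC0 mul1r; congr *%R.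
by apply: eq_bigr => i /negPf ij; rewrite !tnth_upd ij.
Qed.

Lemma is_pd_Exp c j : is_pd j (Exp c) (fun x => c j * Exp c x).
Proof.
move=> x; set a := Exp c (upd x j 0).
have [dr di] := is_derive_cexp (c j) (tnth x j).
have E t : Exp c (upd x j t) = cexp (c j) t * a by exact: Exp_upd.
have Ex : Exp c x = cexp (c j) (tnth x j) * a by rewrite -{1}(upd_id x j).
have Z (f : R -> R) (t df b : R) : is_derive t 1 f df -> is_derive t 1 (fun s => f s * b) (df * b).
  move=> H; have := @is_deriveZ R R R f b t 1 df H.
  by rewrite /GRing.scale /= mulrC; congr is_derive; apply: funext => s; rewrite mulrC.
split.
  under eq_fun do rewrite E ReM.
  have := is_deriveB (Z _ _ _ (complex.Re a) dr) (Z _ _ _ (complex.Im a) di).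
  by congr is_derive; rewrite Ex mulrA [RHS]ReM.
under eq_fun do rewrite E ImM.
have := is_deriveD (Z _ _ _ (complex.Im a) dr) (Z _ _ _ (complex.Re a) di).
by congr is_derive; rewrite Ex mulrA [RHS]ImM.
Qed.

Lemma ccont_cexp (c : R[i]) j : ccontinuous (fun x : Pt => cexp c (tnth x j)).
Proof.
have [cr ci] := continuous_cexp c.
apply/ccontP; split.
  exact (rcont_comp cr (@rcont_tnth R n j)).
exact (rcont_comp ci (@rcont_tnth R n j)).
Qed.

Lemma ccont_Exp c : ccontinuous (Exp c).
Proof. by apply: ccont_prod => j; exact: ccont_cexp. Qed.

Lemma iter_pd_Exp c js : iter_pd js (Exp c) = (fun x => \prod_(j <- js) c j * Exp c x).
Proof.
elim: js => [|j js /= ->].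
  by apply: funext => x; rewrite big_nil mul1r.
rewrite (is_pd_pdC (is_pdZ _ (is_pd_Exp c j))); apply: funext => x.
by rewrite big_cons; ring.
Qed.

Lemma smooth_Exp c : smoothC (Exp c).
Proof.
move=> js; rewrite iter_pd_Exp; split; first by apply: ccontZ; exact: ccont_Exp.
by move=> j; apply: is_pd_pderivable; apply: is_pdZ; exact: is_pd_Exp.
Qed.

Lemma pdC_Exp c j : pdC j (Exp c) = (fun x => c j * Exp c x).
Proof. exact: is_pd_pdC (is_pd_Exp c j). Qed.

Lemma lap_Exp c : lap (Exp c) = (fun x => (\sum_j c j ^+ 2) * Exp c x).
Proof.
apply: funext => x; rewrite /lap mulr_suml; apply: eq_bigr => j _.
by rewrite pdC_Exp (is_pd_pdC (is_pdZ _ (is_pd_Exp c j))) mulrA.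
Qed.

Lemma lapk_Exp c k : lapk k (Exp c) = (fun x => (\sum_j c j ^+ 2) ^+ k * Exp c x).
Proof.
elim: k => [|k /= ->]; first by apply: funext => x; rewrite expr0 mul1r.
have := @lap_lin R n ((\sum_j c j ^+ 2) ^+ k) (Exp c) (fun=> 0) (@smooth_Exp c) (@smooth0 _ _).
under eq_fun do rewrite addr0; move=> ->; apply: funext => x.
have -> : lap (fun _ : Pt => 0 : R[i]) = (fun=> 0) by exact: (@lapk0 R n 1).
by rewrite addr0 lap_Exp exprSr mulrA.
Qed.

End Exponentials.

(** * Measurability and integration over the cube *)

Section Integration.
Variables (R : realType) (n : nat).
Local Notation Pt := (Pt R n).
Implicit Types (F G g : Pt -> R) (x y : Pt) (j : 'I_n).

Lemma measurable_box (A : 'I_n -> set R) : (forall i, measurable (A i)) ->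
  measurable [set x : Pt | forall i, A i (tnth x i)].
Proof.
move=> mA.
have -> : [set x : Pt | forall i, A i (tnth x i)] =
    \big[setI/[set: Pt]]_(i < n) ((fun x : Pt => tnth x i) @^-1` A i).
  rewrite -bigcap_seq; apply/seteqP; split=> x H i; first by move=> _; exact: H.
  by apply: H; rewrite /= mem_index_enum.
apply: bigsetI_measurable => i _; rewrite -[X in measurable X]setTI.
exact: (@measurable_tnth _ R n i).
Qed.

Lemma measurable_Omega : measurable (@Omega R n).
Proof.
have -> : @Omega R n = [set x : Pt | forall i, `]0, 1[%classic (tnth x i)].
  by apply/seteqP; split=> x H i; have := H i; rewrite /= in_itv.
apply: (@measurable_box (fun=> `]0, 1[%classic)) => i; exact: measurable_itv.
Qed.

Lemma measurable_cbox (a b : Pt) :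
  measurable [set x : Pt | forall i, tnth a i <= tnth x i <= tnth b i].
Proof.
have -> : [set x : Pt | forall i, tnth a i <= tnth x i <= tnth b i] =
    [set x : Pt | forall i, `[tnth a i, tnth b i]%classic (tnth x i)].
  by apply/seteqP; split=> x H i; have := H i; rewrite /= in_itv.
apply: (@measurable_box (fun i => `[tnth a i, tnth b i]%classic)) => i.
exact: measurable_itv.
Qed.

(* [F] is the pointwise limit of [x |-> F (floor ((m + 1) x) / (m + 1))], and
   each of these functions takes countably many values on measurable cells. *)
Lemma rcont_measurable F : rcont F -> measurable_fun [set: Pt] F.
Proof.
move=> /rcontP cF.
pose rd (m : nat) (k : n.-tuple int) : Pt := [tuple (tnth k i)%:~R / m.+1%:R | i < n].
pose fl (m : nat) (x : Pt) : n.-tuple int := [tuple Num.floor (m.+1%:R * tnth x i) | i < n].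
apply: (@measurable_fun_cvg _ _ _ _ (fun m x => F (rd m (fl m x)))).
  move=> m _ B mB; rewrite setTI.
  have -> : (fun x => F (rd m (fl m x))) @^-1` B =
      \bigcup_k (if `[< B (F (rd m k)) >] then [set x | fl m x = k] else set0).
    apply/seteqP; split=> [x Bx|x [k _]].
      by exists (fl m x) => //; case: asboolP.
    by case: asboolP => // BF flk; rewrite /= flk.
  apply: countable_bigcupT_measurable => [|k]; first exact: countableP.
  case: asboolP => // _.
  have -> : [set x | fl m x = k] = [set x : Pt | forall i,
      `[(tnth k i)%:~R / m.+1%:R, (tnth k i + 1)%:~R / m.+1%:R[%classic (tnth x i)].
    apply/seteqP; split=> x.
      move=> /= <- i; rewrite /= in_itv /= tnth_mktuple.
      have := floor_itv (m.+1%:R * tnth x i).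
      by rewrite ler_pdivrMr// ltr_pdivlMr// (mulrC (tnth x i)).
    move=> H; apply: eq_from_tnth => i; rewrite tnth_mktuple.
    have := H i; rewrite /= in_itv /= ler_pdivrMr// ltr_pdivlMr// => {}H.
    by apply: floor_def; rewrite (mulrC m.+1%:R).
  apply: (@measurable_box (fun i =>
      `[(tnth k i)%:~R / m.+1%:R, (tnth k i + 1)%:~R / m.+1%:R[%classic)) => i.
  exact: measurable_itv.
move=> x _; apply/cvgrPdist_lt => e e0; have [d d0 H] := cF x e e0.
near=> m; rewrite distrC; apply: H => i; rewrite !tnth_mktuple.
have /andP[h1 h2] := floor_itv (m.+1%:R * tnth x i).
have md : m.+1%:R^-1 < d by near: m; exact: (near_infty_natSinv_lt (PosNum d0)).
apply: le_lt_trans md.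
rewrite -[X in _ - X](mulKf (_ : m.+1%:R != 0 :> R))// [X in _ - X]mulrC.
rewrite -mulrBl normrM [X in _ * X]gtr0_norm// -[leRHS]mul1r ler_pM2r//.
by rewrite ler_norml; apply/andP; split; rewrite ?intrD in h2 *; lra.
Unshelve. all: by end_near. Qed.

Lemma ccont_meas (f : CFun R n) : ccontinuous f -> measC f.
Proof.
move=> /ccontP[cr ci]; split; apply: measurable_funS (measurableT) _ (rcont_measurable _) => //;
  by [exact cr|exact ci].
Qed.

(** Closed cells overlap along faces, but their measure is given directly by [is_lebesgue]; for an
    upper bound on an integral it is enough that they cover. *)
Definition cell N (c : {ffun 'I_n -> 'I_N.+1}) : set Pt :=
  [set x | forall i, (c i)%:R / N.+1%:R <= tnth x i <= (c i).+1%:R / N.+1%:R].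

Lemma cell_cover N x : Omega x -> exists c, @cell N c x.
Proof.
move=> Ox.
pose k i := Num.trunc (N.+1%:R * tnth x i).
have k0 i : 0 <= N.+1%:R * tnth x i by have /andP[/ltW ? _] := Ox i; rewrite mulr_ge0.
have kN i : (k i < N.+1)%N.
  have /andP[h1 _] := trunc_itv (k0 i).
  rewrite -(ltr_nat R); apply: le_lt_trans h1 _.
  by have /andP[_ ?] := Ox i; rewrite -[ltRHS]mulr1 ltr_pM2l.
exists [ffun i => Ordinal (kN i)] => i; rewrite ffunE /=.
have /andP[h1 /ltW h2] := trunc_itv (k0 i).
by rewrite ler_pdivrMr// ler_pdivlMr// (mulrC (tnth x i)) h1 h2.
Qed.

Lemma cell_dist N c x y i : @cell N c x -> @cell N c y ->
  `|tnth x i - tnth y i| <= N.+1%:R^-1.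
Proof.
move=> /(_ i) /andP[a b] /(_ i) /andP[a' b'].
have E : (c i).+1%:R / N.+1%:R = (c i)%:R / N.+1%:R + N.+1%:R^-1 :> R.
  by rewrite -natr1 mulrDl mul1r.
move: a b a' b'; rewrite E; set u := _%:R / _; set v := _^-1; clearbody u v => *.
by rewrite ler_norml; apply/andP; split; lra.
Qed.

Variable mu : {measure set Pt -> \bar R}.
Hypothesis mu_leb : is_lebesgue mu.

Lemma measurable_cell N c : measurable (@cell N c).
Proof.
have := measurable_cbox [tuple (c i)%:R / N.+1%:R | i < n] [tuple (c i).+1%:R / N.+1%:R | i < n].
by congr measurable; apply/seteqP; split=> x H i; have := H i; rewrite !tnth_mktuple.
Qed.

Lemma mu_cell N c : mu (@cell N c) = (N.+1%:R^-1 ^+ n)%:E.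
Proof.
have := mu_leb (a := [tuple (c i)%:R / N.+1%:R | i < n]) (b := [tuple (c i).+1%:R / N.+1%:R | i < n]).
under eq_bigr do rewrite !tnth_mktuple -mulrBl -natr1 addrAC subrr add0r mul1r.
rewrite prodr_const card_ord => <-.
  by congr (mu _); apply/seteqP; split=> x H i; have := H i; rewrite !tnth_mktuple.
by move=> i; rewrite !tnth_mktuple ler_pM2r// ler_nat.
Qed.

Lemma mu_cbox_eps (e : R) : 0 <= e <= 2^-1 ->
  mu [set x : Pt | forall i, e <= tnth x i <= 1 - e] = ((1 - 2 * e) ^+ n)%:E.
Proof.
move=> /andP[e0 e1].
have := mu_leb (a := [tuple e | i < n]) (b := [tuple 1 - e | i < n]).
under eq_bigr do rewrite !tnth_mktuple.
rewrite prodr_const card_ord => H.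
have -> : 1 - 2 * e = 1 - e - e by ring.
rewrite -H; last by move=> i; rewrite !tnth_mktuple; lra.
by congr (mu _); apply/seteqP; split=> x Hx i; have := Hx i; rewrite !tnth_mktuple.
Qed.

Lemma Bernoulli_ineq (e : R) (k : nat) : 0 <= e <= 1 -> 1 - k%:R * e <= (1 - e) ^+ k.
Proof.
move=> /andP[e0 e1]; elim: k => [|k IH]; first by rewrite mul0r subr0 expr0.
have e1' : 0 <= 1 - e by rewrite subr_ge0.
have := ler_wpM2r e1' IH; rewrite -exprSr; apply: le_trans.
by have := mulr_ge0 (mulr_ge0 (ler0n R k) e0) e0; rewrite -natr1; lra.
Qed.

(** The open cube is squeezed between the closed unit box and the boxes [[e, 1 - e]^n], whose
    measure is at least [1 - 2 n e] by Bernoulli's inequality. *)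
Lemma mu_Omega : mu (@Omega R n) = 1%E.
Proof.
have mO := measurable_Omega.
have mB (e : R) : measurable [set x : Pt | forall i, e <= tnth x i <= 1 - e].
  have := measurable_cbox [tuple e | i < n] [tuple 1 - e | i < n].
  by congr measurable; apply/seteqP; split=> x H i; have := H i; rewrite !tnth_mktuple.
have le1 : (mu (@Omega R n) <= 1)%E.
  have -> : 1%E = mu [set x : Pt | forall i, 0 <= tnth x i <= 1 - 0].
    by rewrite mu_cbox_eps ?mulr0 ?subr0 ?expr1n// lexx invr_ge0 ler0n.
  apply: le_measure; rewrite ?inE//.
  by move=> x Ox i; have /andP[/ltW-> /ltW] := Ox i; rewrite subr0.
have ge1 (e : R) : 0 < e <= 4^-1 -> ((1 - n%:R * (2 * e))%:E <= mu (@Omega R n))%E.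
  move=> /andP[e0 e1]; apply: (@le_trans _ _ (mu [set x : Pt | forall i, e <= tnth x i <= 1 - e])).
    rewrite mu_cbox_eps; last by lra.
    by rewrite lee_fin Bernoulli_ineq//; lra.
  apply: le_measure; rewrite ?inE// => x xe i; have /andP[a b] := xe i.
  by apply/andP; split; lra.
have : mu (@Omega R n) \is a fin_num.
  by rewrite ge0_fin_numE// (le_lt_trans le1)// ltry.
move: le1 ge1; case: (mu _) => [m| |]// + + _; rewrite lee_fin => m1 H.
congr EFin; apply/eqP; rewrite eq_le m1 /= leNgt; apply/negP => mlt.
(* The second entry gives [4 (n + 1) e <= 1 - m], so the loss [2 n e] stays below [1 - m]; the first
   keeps [e] in the range of [ge1]. *)
pose e := Order.min 4^-1 ((1 - m) / (4 * n.+1%:R)).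
have e0 : 0 < e by rewrite lt_min invr_gt0 ltr0n /= divr_gt0 ?mulr_gt0// subr_gt0.
have := H e; rewrite e0 ge_min lexx lee_fin /= => /(_ isT); apply/negP; rewrite -ltNge.
have ee : e * (4 * n.+1%:R) <= 1 - m.
  by rewrite -ler_pdivlMr ?mulr_gt0// ge_min lexx orbT.
have : 0 <= n%:R * e by rewrite mulr_ge0// ltW.
by rewrite -natr1 in ee; lra.
Qed.

(** [F] is dominated by the sum of [a c] times the indicator of each cell; the overlaps only enlarge
    this sum since [a] is nonnegative. *)
Lemma integral_cells N F (a : {ffun 'I_n -> 'I_N.+1} -> R) :
  measurable_fun (@Omega R n) F ->
  (forall x, Omega x -> 0 <= F x) -> (forall c, 0 <= a c) ->
  (forall c x, Omega x -> cell c x -> F x <= a c) ->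
  (\int[mu]_(x in @Omega R n) (F x)%:E <= (N.+1%:R^-1 ^+ n * \sum_c a c)%:E)%E.
Proof.
move=> mF F0 a0 Fa; have mO := measurable_Omega.
have mc c : measurable_fun (@Omega R n) (EFin \o (fun x => a c * \1_(cell c) x)).
  apply/measurable_EFinP; apply: measurable_funM => //.
  exact: measurable_indic (measurable_cell c).
have c0 c x : (0 <= (a c * \1_(@cell N c) x)%:E)%E.
  by rewrite lee_fin mulr_ge0.
apply: (@le_trans _ _ (\int[mu]_(x in @Omega R n)
    (\sum_(c <- index_enum {ffun 'I_n -> 'I_N.+1}) (a c * \1_(cell c) x)%:E)%R)%E).
  apply: ge0_le_integral => //.
  - exact/measurable_EFinP.
  - exact: emeasurable_sum.
  - move=> x Ox; have [c cx] := cell_cover N Ox.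
    rewrite (bigD1 c)//= indicE mem_set// mulr1 -[leLHS]adde0.
    by apply: leeD; rewrite ?lee_fin ?Fa// sume_ge0.
rewrite ge0_integral_sum// mulr_sumr -sumEFin; apply: lee_sum => c _.
under eq_integral do rewrite EFinM.
rewrite ge0_integralZl_EFin//; last first.
  by apply/measurable_EFinP; exact: measurable_indic (measurable_cell c).
rewrite integral_indic//; last exact: measurable_cell.
rewrite mulrC EFinM lee_wpmul2l ?lee_fin// -(mu_cell c).
apply: le_measure; rewrite ?inE//; [|exact: measurable_cell].
by apply: measurableI => //; exact: measurable_cell.
Qed.

Lemma rcont_bounded F : rcont F ->
  exists2 C : R, 0 <= C & forall x, cube x -> `|F x| <= C.
Proof.
move=> /ccont_real/cube_bounded[C C0 H]; exists C => // x /H.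
by rewrite normcC.
Qed.

Lemma rcont_integrable F : rcont F -> mu.-integrable (@Omega R n) (EFin \o F).
Proof.
move=> cF; apply: measurable_bounded_integrable.
- exact: measurable_Omega.
- by rewrite mu_Omega ltry.
- exact: measurable_funS (measurableT) _ (rcont_measurable cF).
- have [C C0 H] := rcont_bounded cF.
  exists C; split; first exact: num_real.
  by move=> M CM x /Omega_cube/H /le_trans; apply; exact: ltW.
Qed.

Lemma Rintegral_Omega_cst (a : R) : \int[mu]_(x in @Omega R n) a = a.
Proof.
rewrite Rintegral_cst; last exact: measurable_Omega.
by rewrite mu_Omega mulr1.
Qed.

(** * The integral of a partial derivative of a periodic function vanishes *)

Section PeriodicDerivative.
Variables (G g : Pt -> R) (j : 'I_n).
Hypothesis dG : forall x, is_derive (tnth x j) 1 (fun t => G (upd x j t)) (g x).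
Hypothesis perG : forall y, Omega y -> G (upd y j 0) = G (upd y j 1).

(** Centres of cells are interior to the cube, where [perG] applies. *)
Let mid N (c : {ffun 'I_n -> 'I_N.+1}) : Pt :=
  [tuple ((c i)%:R + 2^-1) / N.+1%:R | i < n].

Let mid_Omega N c : Omega (@mid N c).
Proof.
move=> i; rewrite tnth_mktuple divr_gt0//= ?ltr_wpDl// ltr_pdivrMr// mul1r.
have : (c i)%:R + 1 <= N.+1%:R :> R by rewrite natr1 ler_nat.
by have := ler0n R (c i); lra.
Qed.

Let dline y (t : R) : is_derive t 1 (fun s => G (upd y j s)) (g (upd y j t)).
Proof.
have := dG (upd y j t); rewrite tnth_upd eqxx.
by under eq_fun do rewrite upd_upd.
Qed.

(** The mean value theorem on the segment through the centre of the cell in direction [j]: the tag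
    stays in the cell, and the Riemann sum of [g] over the tags is exactly a sum of increments of
    [G]. *)
Let tagP N (c : {ffun 'I_n -> 'I_N.+1}) : exists x, cell c x /\
  G (upd (mid c) j ((c j).+1%:R / N.+1%:R)) - G (upd (mid c) j ((c j)%:R / N.+1%:R)) =
  g x / N.+1%:R.
Proof.
have ab : (c j)%:R / N.+1%:R < (c j).+1%:R / N.+1%:R :> R by rewrite ltr_pM2r// ltr_nat.
have [|t] := MVT ab (fun t _ => dline (mid c) t).
  by apply: derivable_within_continuous => t _; have [] := dline (mid c) t.
rewrite in_itv /= => /andP[/ltW a /ltW b] E; exists (upd (mid c) j t); split; last first.
  by rewrite E; congr (_ * _); rewrite -mulrBl -natr1 addrAC subrr add0r mul1r.
move=> i; rewrite tnth_upd; case: eqP => [->|_]; first by rewrite a b.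
by rewrite tnth_mktuple !ler_pM2r ?invr_gt0// lerDl -[X in _ && (_ <= X)]natr1 lerD2l invr_ge0 ler0n invf_le1// ler1n.
Qed.

Let shift N (c : {ffun 'I_n -> 'I_N.+1}) : {ffun 'I_n -> 'I_N.+1} :=
  [ffun i => if i == j then ordS (c i) else c i].

Let shift_bij N : bijective (@shift N).
Proof.
exists (fun c : {ffun 'I_n -> 'I_N.+1} => [ffun i => if i == j then ord_pred (c i) else c i]) => c;
  apply/ffunP => i; rewrite !ffunE; case: eqP => // _; [exact: ordSK|exact: ord_predK].
Qed.

(* The increments of [G] over the cells of a row telescope around the torus:
   the increment over [c] is [K (shift c) - K c]. *)
Let sum_tags N (tag : {ffun 'I_n -> 'I_N.+1} -> Pt) :
  (forall c, G (upd (mid c) j ((c j).+1%:R / N.+1%:R)) - G (upd (mid c) j ((c j)%:R / N.+1%:R)) =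
  g (tag c) / N.+1%:R) -> \sum_c g (tag c) = 0.
Proof.
move=> E.
pose K (c : {ffun 'I_n -> 'I_N.+1}) := G (upd (mid c) j ((c j)%:R / N.+1%:R)).
have KS c : G (upd (mid c) j ((c j).+1%:R / N.+1%:R)) = K (shift c).
  have U t : upd (mid (shift c)) j t = upd (mid c) j t.
    apply: eq_from_tnth => i; rewrite !tnth_upd; case: eqP => // /eqP/negPf ij.
    by rewrite !tnth_mktuple ffunE ij.
  (* In the last cell of a row [ordS] wraps around to 0, and periodicity replaces the value of [G]
     at 1 by its value at 0. *)
  rewrite /K U ffunE eqxx /=; have := ltn_ord (c j); rewrite leq_eqVlt => /orP[/eqP ->|cN].
    by rewrite modnn mul0r divff// perG.
  by rewrite modn_small.
have : \sum_c g (tag c) / N.+1%:R = 0.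
  under eq_bigr do rewrite -E KS.
  rewrite sumrB [X in X - _](_ : _ = \sum_c K c) ?subrr//.
  by rewrite [RHS](reindex (@shift N))//; exact/onW_bij/shift_bij.
by rewrite -mulr_suml => /eqP; rewrite mulf_eq0 invr_eq0 pnatr_eq0 orbF => /eqP.
Qed.

(** On each cell [g] exceeds its tag value by at most [e0], and the tag values sum to 0. One
    inequality is enough, since it also applies to [- G]. *)
Lemma integral_pd_le0 : rcont g -> \int[mu]_(x in @Omega R n) g x <= 0.
Proof.
move=> cg; have [B B0 gB] := rcont_bounded cg.
apply/ler_addgt0Pr => e0 e0_gt0; rewrite add0r.
have e_gt0 : 0 < e0 / 2 by lra.
have [C C0 H] := cube_unif_cont (ccont_real cg) e_gt0.
(* Coordinates vary by at most [1 / (N + 1)] in a cell, so the oscillation term is at most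
   [C n / (N + 1)], which this [N] brings below [e0 / 2]. *)
pose N := Num.trunc (C * n%:R / (e0 / 2)).
have N1 : C * (n%:R / N.+1%:R) <= e0 / 2.
  rewrite mulrA ler_pdivrMr// [leRHS]mulrC -ler_pdivrMr//.
  have x0 : 0 <= C * n%:R / (e0 / 2) by rewrite divr_ge0 ?mulr_ge0// ltW.
  by have /andP[_ /ltW] := trunc_itv x0.
have /choice[tag tagE] := @tagP N.
have cell_cube (c : {ffun 'I_n -> 'I_N.+1}) x : cell c x -> cube x.
  move=> cx i; have /andP[a b] := cx i; apply/andP; split.
    by apply: le_trans a; rewrite divr_ge0.
  by apply: le_trans b _; rewrite ler_pdivrMr// mul1r ler_nat.
(* The shift by [B], a bound of [|g|], makes both sides nonnegative as [integral_cells] requires; it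
   cancels at the end because the cube has mass 1. *)
pose a c := g (tag c) + (B + e0).
have a0 c : 0 <= a c.
  have := gB _ (cell_cube _ _ (tagE c).1); rewrite ler_norml => /andP[? _].
  by rewrite /a; lra.
have ga c x : Omega x -> cell c x -> g x + B <= a c.
  move=> Ox cx; have := H _ _ (cell_cube _ _ cx) (cell_cube _ _ (tagE c).1).
  rewrite -rmorphB normcC => H'.
  have S : \sum_i `|tnth x i - tnth (tag c) i| <= n%:R / N.+1%:R.
    have -> : n%:R / N.+1%:R = \sum_(i < n) N.+1%:R^-1 :> R.
      by rewrite sumr_const card_ord mulr_natl.
    by apply: ler_sum => i _; exact: cell_dist cx (tagE c).1.
  have := le_trans H' (lerD (lexx _) (le_trans (ler_wpM2l C0 S) N1)).
  by move=> /(le_trans (ler_norm _)); rewrite /a; lra.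
have mg : measurable_fun (@Omega R n) (fun x => g x + B).
  exact: measurable_funS measurableT _ (rcont_measurable (rcontD cg (@rcont_cst _ _ B))).
have g0 x : Omega x -> 0 <= g x + B.
  by move=> /Omega_cube/gB; rewrite ler_norml => /andP[? _]; lra.
have := integral_cells mg g0 a0 ga.
rewrite big_split /= (sum_tags (fun c => (tagE c).2)) add0r sumr_const.
rewrite card_ffun !card_ord -[_ *+ (_ ^ _)]mulr_natr natrX mulrCA -exprMn mulVf// expr1n mulr1.
have ig := rcont_integrable (rcontD cg (@rcont_cst _ _ B)).
move=> I; have : \int[mu]_(x in @Omega R n) (g x + B) <= B + e0.
  have fi := integrable_fin_num measurable_Omega ig.
  by rewrite -lee_fin /Rintegral (fineK fi).
rewrite RintegralD ?Rintegral_Omega_cst; [lra|exact: measurable_Omega|exact: rcont_integrable|].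
exact: rcont_integrable (@rcont_cst _ _ B).
Qed.

End PeriodicDerivative.

Lemma integral_pd0 G g j : (forall x, is_derive (tnth x j) 1 (fun t => G (upd x j t)) (g x)) ->
  (forall y, Omega y -> G (upd y j 0) = G (upd y j 1)) ->
  rcont g -> \int[mu]_(x in @Omega R n) g x = 0.
Proof.
move=> dG pG cg; apply/eqP; rewrite eq_le (integral_pd_le0 dG pG cg) /=.
have : \int[mu]_(x in @Omega R n) (- g x) <= 0.
  apply: (@integral_pd_le0 (fun x => - G x) (fun x => - g x) j).
  - by move=> y /pG ->.
  - exact: (rcontN cg).
under eq_Rintegral do rewrite -mulN1r.
rewrite RintegralZl; [|exact: measurable_Omega|exact: rcont_integrable].
by rewrite mulN1r oppr_le0.
Qed.

End Integration.

(** * Integrals of complex functions *)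

Section ComplexIntegral.
Variables (R : realType) (n : nat).
Local Notation Pt := (Pt R n).
Local Notation CFun := (CFun R n).
Local Notation Om := (@Omega R n).
Variable mu : {measure set Pt -> \bar R}.
Hypothesis mu_leb : is_lebesgue mu.
Implicit Types (f g : CFun).

Definition Cint f : R[i] :=
  (\int[mu]_(x in Om) complex.Re (f x)) +i* (\int[mu]_(x in Om) complex.Im (f x)).

Definition cintegrable f : Prop :=
  mu.-integrable Om (EFin \o (fun x => complex.Re (f x))) /\
  mu.-integrable Om (EFin \o (fun x => complex.Im (f x))).

Lemma ccont_integrable f : ccontinuous f -> cintegrable f.
Proof. by move=> /ccontP[cr ci]; split; apply: rcont_integrable. Qed.

Lemma eq_Cint f g : (forall x, Omega x -> f x = g x) -> Cint f = Cint g.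
Proof.
move=> fg; rewrite /Cint; congr Complex; apply: eq_Rintegral => x /set_mem Ox;
  by rewrite fg.
Qed.

Lemma CintD f g : cintegrable f -> cintegrable g ->
  Cint (fun x => f x + g x) = Cint f + Cint g.
Proof.
move=> [fr fi] [gr gi]; have mO := @measurable_Omega R n.
apply: complexP; rewrite ?ReD ?ImD /=.
  by under eq_Rintegral do rewrite ReD; rewrite RintegralD.
by under eq_Rintegral do rewrite ImD; rewrite RintegralD.
Qed.

Lemma integrable_comb (F G : Pt -> R) (a b : R) :
  mu.-integrable Om (EFin \o F) -> mu.-integrable Om (EFin \o G) ->
  mu.-integrable Om (EFin \o (fun x => a * F x + b * G x)) /\
  \int[mu]_(x in Om) (a * F x + b * G x) =
    a * (\int[mu]_(x in Om) F x) + b * (\int[mu]_(x in Om) G x).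
Proof.
have mO := @measurable_Omega R n.
move=> iF iG.
have iaF : mu.-integrable Om (EFin \o (fun x => a * F x)).
  by have := integrableZl mO a iF; apply: eq_integrable => // x _ /=; rewrite EFinM.
have ibG : mu.-integrable Om (EFin \o (fun x => b * G x)).
  by have := integrableZl mO b iG; apply: eq_integrable => // x _ /=; rewrite EFinM.
split; last by rewrite RintegralD// !RintegralZl.
by have := integrableD mO iaF ibG; apply: eq_integrable => // x _ /=; rewrite EFinD.
Qed.

Lemma CintZ_integrable (a : R[i]) f : cintegrable f ->
  cintegrable (fun x => a * f x) /\ Cint (fun x => a * f x) = a * Cint f.
Proof.
move=> [fr fi].
have [ir er] := integrable_comb (complex.Re a) (- complex.Im a) fr fi.
have [ii ei] := integrable_comb (complex.Re a) (complex.Im a) fi fr.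
have Er x : complex.Re (a * f x) = complex.Re a * complex.Re (f x) + - complex.Im a * complex.Im (f x).
  by rewrite ReM mulNr.
have Ei x : complex.Im (a * f x) = complex.Re a * complex.Im (f x) + complex.Im a * complex.Re (f x).
  by rewrite ImM.
split; first by split; [rewrite (funext Er)|rewrite (funext Ei)].
apply: complexP; rewrite ?ReM ?ImM /=.
  by under eq_Rintegral do rewrite Er; rewrite er mulNr.
by under eq_Rintegral do rewrite Ei; rewrite ei.
Qed.

Lemma cintegrableZ (a : R[i]) f : cintegrable f -> cintegrable (fun x => a * f x).
Proof. by move=> /(CintZ_integrable a)[]. Qed.

Lemma CintZ (a : R[i]) f : cintegrable f -> Cint (fun x => a * f x) = a * Cint f.
Proof. by move=> /(CintZ_integrable a)[]. Qed.

Lemma Cint_cst (a : R[i]) : Cint (fun=> a) = a.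
Proof. by rewrite /Cint !(Rintegral_Omega_cst mu_leb); case: a. Qed.

Lemma CintB f g : cintegrable f -> cintegrable g ->
  Cint (fun x => f x - g x) = Cint f - Cint g.
Proof.
move=> cf cg; rewrite -[in RHS](mulN1r (Cint g)) -CintZ// -CintD//.
  by apply: eq_Cint => x _; rewrite mulN1r.
exact: cintegrableZ.
Qed.

Lemma Cint_sum I (s : seq I) (c : I -> R[i]) (f : I -> CFun) :
  (forall i, ccontinuous (f i)) ->
  Cint (fun x => \sum_(i <- s) c i * f i x) = \sum_(i <- s) c i * Cint (f i).
Proof.
move=> cf; elim: s => [|i s IH].
  by rewrite big_nil -[RHS]Cint_cst; apply: eq_Cint => x _; rewrite big_nil.
rewrite big_cons -IH -CintZ; last exact: ccont_integrable.
rewrite -CintD; [|by apply: cintegrableZ; exact: ccont_integrable|].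
  by apply: eq_Cint => x _; rewrite big_cons.
by apply: ccont_integrable; apply: ccont_sum => k; exact: ccontZ.
Qed.

Lemma measurable_normc f : measC f -> measurable_fun Om (fun x => normc (f x)).
Proof.
move=> [mr mi].
have -> : (fun x => normc (f x)) =
    Num.sqrt \o (fun x => complex.Re (f x) ^+ 2 + complex.Im (f x) ^+ 2).
  by apply: funext => x /=; rewrite -normc_sqr sqrtr_sqr ger0_norm// normc_ge0.
have ms : measurable_fun [set: R] (Num.sqrt : R -> R).
  by apply: continuous_measurable_fun; exact: sqrt_continuous.
apply: (measurableT_comp ms).
by apply: measurable_funD; exact: measurable_funX.
Qed.

(** Real and imaginary parts are each bounded by the integral of the modulus, whence the factor 2,
    which enters the final constant. *)
Lemma normc_Cint f : cintegrable f ->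
  ((normc (Cint f))%:E <= 2%:E * \int[mu]_(x in Om) (normc (f x))%:E)%E.
Proof.
have mO := @measurable_Omega R n.
move=> [ir ii]; have [mr _] := integrableP _ _ _ ir; have [mi _] := integrableP _ _ _ ii.
have mf : measC f by split; exact/measurable_EFinP.
have mn : measurable_fun Om (EFin \o (fun x => normc (f x))).
  by apply/measurable_EFinP; exact: measurable_normc.
have key (F : Pt -> R) : mu.-integrable Om (EFin \o F) -> (forall x, `|F x| <= normc (f x)) ->
    (`|\int[mu]_(x in Om) F x|%:E <= \int[mu]_(x in Om) (normc (f x))%:E)%E.
  move=> iF leF; have [mF _] := integrableP _ _ _ iF.
  rewrite (EFin_normr_Rintegral mO iF); apply: le_trans (le_abse_integral mu mO mF) _.
  apply: ge0_le_integral => //.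
  - exact: measurableT_comp.
  - by move=> x _; rewrite /= lee_fin.
apply: (@le_trans _ _ (`|complex.Re (Cint f)|%:E + `|complex.Im (Cint f)|%:E)%E).
  by rewrite -EFinD lee_fin normc_le_ReIm.
rewrite -[2%:R](@natrD R 1 1) EFinD ge0_muleDl ?lee_fin// !mul1e.
by apply: leeD; apply: key => // x; [exact: normc_Re|exact: normc_Im].
Qed.

Lemma Cint_pd0 j f g : is_pd j f g -> ccontinuous g ->
  (forall y, Omega y -> f (upd y j 0) = f (upd y j 1)) -> Cint g = 0.
Proof.
move=> fg /ccontP[cr ci] per.
have Er := @integral_pd0 _ _ _ mu_leb (fun x => complex.Re (f x)) _ j (fun x => (fg x).1) _ cr.
have Ei := @integral_pd0 _ _ _ mu_leb (fun x => complex.Im (f x)) _ j (fun x => (fg x).2) _ ci.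
by rewrite /Cint Er ?Ei// => y Oy; rewrite per.
Qed.

End ComplexIntegral.

(** * Characters of the torus: orthogonality and best approximation *)

Section FourierSystem.
Variables (R : realType) (n : nat).
Local Notation Pt := (Pt R n).
Local Notation CFun := (CFun R n).
Local Notation Om := (@Omega R n).
Local Notation Zn := (n.-tuple int).
Implicit Types (f g F : CFun) (xi eta : Zn).

(** The exponent [2 pi i xi_j], so that [Exp (freq xi)] is the character e^{2 pi i xi.x}. *)
Definition freq xi (j : 'I_n) : R[i] := 0 +i* (2 * pi * (tnth xi j)%:~R).

Lemma expiN (t : R) : expi (- t) = (expi t)^*%C.
Proof. by rewrite /expi cosN sinN. Qed.

Lemma mul_conj0 (z : R[i]) : z * 0^*%C = 0.
Proof. by rewrite rmorph0 mulr0. Qed.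

Lemma expi2pi (k : int) : expi (2 * pi * k%:~R) = 1 :> R[i].
Proof.
have H (m : nat) : expi (2 * pi * m%:R) = 1 :> R[i].
  elim: m => [|m IH]; first by rewrite mulr0 expi0.
  by rewrite -[m.+1%:R]natr1 mulrDr mulr1 expiD IH mul1r /expi mulr_natl cos2pi sin2pi.
case: k => m; first exact: H.
by rewrite NegzE mulrNz mulrN expiN H conjc1.
Qed.

Lemma cexp_freq1 xi j : cexp (freq xi j) 1 = 1.
Proof. by rewrite /cexp /= mul0r expR0 mulr1 expi2pi mulr1. Qed.

Definition tadd xi eta : Zn := [tuple tnth xi i + tnth eta i | i < n].
Definition topp xi : Zn := [tuple - tnth xi i | i < n].

Lemma freqD xi eta : freq (tadd xi eta) = (fun j => freq xi j + freq eta j).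
Proof.
apply: funext => j; rewrite /freq tnth_mktuple intrD.
by apply: complexP; rewrite ?ReD ?ImD /=; ring.
Qed.

Lemma freqN xi : freq (topp xi) = (fun j => - freq xi j).
Proof.
apply: funext => j; rewrite /freq tnth_mktuple mulrNz.
by apply: complexP; rewrite ?ReN ?ImN /=; ring.
Qed.

Lemma normc_Exp_freq xi x : normc (Exp (freq xi) x) = 1.
Proof.
rewrite /Exp normc_prod big1// => j _.
by rewrite normc_cexp /= mul0r expR0.
Qed.

Lemma conj_Exp_freq xi x : (Exp (freq xi) x)^*%C = Exp (freq (topp xi)) x.
Proof.
rewrite /Exp rmorph_prod; apply: eq_bigr => j _; rewrite freqN.
by rewrite !cexpE /= !mul0r oppr0 !mul0r mulNr cosN sinN mulrN.
Qed.

Lemma Exp_freq_per xi (x : Pt) j : Exp (freq xi) (upd x j 0) = Exp (freq xi) (upd x j 1).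
Proof. by rewrite [RHS]Exp_upd cexp_freq1 mul1r. Qed.

Variable mu : {measure set Pt -> \bar R}.
Hypothesis mu_leb : is_lebesgue mu.
Local Notation Cint := (Cint mu).

(** If [xi_j] is nonzero, the character is the [x_j]-derivative of a periodic function, namely
    itself divided by [2 pi i xi_j]; no iterated integral is involved. *)
Lemma Cint_Exp_freq xi : Cint (Exp (freq xi)) = (xi == [tuple 0 | i < n])%:R.
Proof.
have [->|/eqP xi0] := eqVneq.
  rewrite -[RHS](Cint_cst mu_leb); apply: eq_Cint => x _.
  rewrite /Exp big1// => j _; rewrite /freq tnth_mktuple mulr0; exact: cexp0.
have [j xij] : exists j, tnth xi j != 0.
  apply/existsP; rewrite -negb_forall; apply/negP => /forallP H; apply: xi0.
  by apply: eq_from_tnth => i; rewrite tnth_mktuple; exact/eqP/H.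
have c0 : freq xi j != 0.
  rewrite eq_complex /= eqxx /= !mulf_neq0 ?pnatr_eq0 ?intr_eq0//.
  by rewrite gt_eqF// pi_gt0.
have := @Cint_pd0 _ _ _ mu_leb j _ _ (is_pdZ (freq xi j)^-1 (is_pd_Exp (freq xi) j)).
rewrite (_ : (fun x => _) = Exp (freq xi)); last first.
  by apply: funext => x; rewrite mulrA mulVf// mul1r.
move=> -> //; first exact: ccont_Exp.
by move=> y _; rewrite Exp_freq_per.
Qed.

(* Position [pickle xi] of the enumeration carries the frequency [xi]; the
   other positions carry [0]. *)
Definition at_freq (T : Type) (z : T) (F : Zn -> T) (k : nat) : T :=
  if @pickle_inv Zn k is Some xi then F xi else z.

Definition fexp (k : nat) : CFun := at_freq (fun=> 0) (fun xi => Exp (freq xi)) k.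

Lemma ccont_fexp k : ccontinuous (fexp k).
Proof.
rewrite /fexp /at_freq; case: pickle_inv => [xi|]; [exact: ccont_Exp|exact: ccont_cst].
Qed.

Lemma ccont_conj f : ccontinuous f -> ccontinuous (fun x => (f x)^*%C).
Proof.
move=> /ccontP[cr ci]; apply/ccontP; split.
  by have -> : (fun x => complex.Re (f x)^*%C) = (fun x => complex.Re (f x))
    by apply: funext => x; case: (f x).
have -> : (fun x => complex.Im (f x)^*%C) = (fun x => - complex.Im (f x))
    by apply: funext => x; case: (f x).
exact (rcontN ci).
Qed.

Definition fcoef F k : R[i] := Cint (fun x => F x * (fexp k x)^*%C).

Lemma Cint_fexp k l : Cint (fun x => fexp l x * (fexp k x)^*%C) =
  ((k == l) && isSome (@pickle_inv Zn k))%:R.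
Proof.
rewrite /fexp /at_freq.
case Ek : (pickle_inv k) => [xi|]; last first.
  rewrite andbF -[RHS](Cint_cst mu_leb); apply: eq_Cint => x _.
  by rewrite mul_conj0.
case El : (pickle_inv l) => [eta|]; last first.
  rewrite andbT (_ : (k == l) = false); last by apply/eqP => kl; rewrite kl El in Ek.
  by rewrite -[RHS](Cint_cst mu_leb); apply: eq_Cint => x _; rewrite mul0r.
rewrite andbT (@eq_Cint _ _ _ _ (Exp (freq (tadd eta (topp xi))))); last first.
  by move=> x _ /=; rewrite conj_Exp_freq -ExpD freqD.
rewrite Cint_Exp_freq; congr (nat_of_bool _)%:R.
have kE := @pickle_invK Zn k; have lE := @pickle_invK Zn l.
rewrite Ek /= in kE; rewrite El /= in lE; rewrite -kE -lE (inj_eq (pcan_inj pickleK)).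
apply/eqP/eqP => [E|->].
  apply: eq_from_tnth => i; have := congr1 (fun t : Zn => tnth t i) E.
  by rewrite !tnth_mktuple => /eqP; rewrite subr_eq0 => /eqP.
by apply: eq_from_tnth => i; rewrite !tnth_mktuple subrr.
Qed.

Lemma fcoef_none F k : @pickle_inv Zn k = None -> fcoef F k = 0.
Proof.
move=> E; rewrite /fcoef -[RHS](Cint_cst mu_leb); apply: eq_Cint => x _.
by rewrite /fexp /at_freq E mul_conj0.
Qed.

Lemma sum_delta N (k : 'I_N) (a : nat -> R[i]) :
  \sum_(l < N) a l * (k == l :> nat)%:R = a k.
Proof.
rewrite (bigD1 k) //= eqxx mulr1 big1 ?addr0// => l lk.
by rewrite (_ : (_ == _) = false) ?mulr0//; apply/negbTE; rewrite eq_sym.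
Qed.

(** The residual [D] is orthogonal to the first [N] exponentials, hence to the difference [V] of the
    two sums. Comparison with an arbitrary competitor is what lets uniform density imply L^2
    convergence. *)
Lemma best_approx F (t : nat -> R[i]) N : ccontinuous F ->
  \int[mu]_(x in Om) (normc (F x - \sum_(k < N) fcoef F k * fexp k x) ^+ 2) <=
  \int[mu]_(x in Om) (normc (F x - \sum_(k < N) t k * fexp k x) ^+ 2).
Proof.
move=> cF.
set c := fcoef F.
pose S (a : nat -> R[i]) : CFun := fun x => \sum_(k < N) a k * fexp k x.
have cS a : ccontinuous (S a) by apply: ccont_sum => k; apply: ccontZ; exact: ccont_fexp.
pose D : CFun := fun x => F x - S c x.
have cD : ccontinuous D by exact: (ccontB cF (cS c)).
pose V := S (fun k => c k - t k).
(* At a position that carries no frequency both the coefficient and the exponential are 0. *)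
have orth (k : 'I_N) : Cint (fun x => D x * (fexp k x)^*%C) = 0.
  have -> : Cint (fun x => D x * (fexp k x)^*%C) =
      c k - Cint (fun x => \sum_(l < N) c l * (fexp l x * (fexp k x)^*%C)).
    rewrite -CintB.
    - by apply: eq_Cint => x _; rewrite mulrBl mulr_suml; under eq_bigr do rewrite -mulrA.
    - exact: (ccont_integrable mu_leb (ccontM cF (ccont_conj (ccont_fexp k)))).
    - apply: (ccont_integrable mu_leb); apply: ccont_sum => l; apply: ccontZ.
      exact: (ccontM (ccont_fexp l) (ccont_conj (ccont_fexp k))).
  rewrite Cint_sum; [|exact: mu_leb|]; last first.
    by move=> l; exact: (ccontM (ccont_fexp l) (ccont_conj (ccont_fexp k))).
  under eq_bigr do rewrite Cint_fexp.
  case Ek : (pickle_inv (k : nat)) => [xi|] /=.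
    by under eq_bigr do rewrite andbT; rewrite sum_delta subrr.
  by rewrite big1 => [|l _]; rewrite ?andbF ?mulr0// /c fcoef_none// subrr.
have DV : Cint (fun x => D x * (V x)^*%C) = 0.
  rewrite (@eq_Cint _ _ _ _ (fun x => \sum_(k < N) (c k - t k)^*%C * (D x * (fexp k x)^*%C))).
    rewrite Cint_sum; [|exact: mu_leb|].
      by rewrite big1// => k _; rewrite orth mulr0.
    by move=> k; exact: (ccontM cD (ccont_conj (ccont_fexp k))).
  move=> x _; rewrite /V /S rmorph_sum mulr_sumr; apply: eq_bigr => k _.
  by rewrite rmorphM /=; ring.
have mO := @measurable_Omega R n.
have cDV : ccontinuous (fun x => D x * (V x)^*%C) by exact: (ccontM cD (ccont_conj (cS _))).
have ir := (ccont_integrable mu_leb cDV).1.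
have rD := rcontM (rcont_normc cD) (rcont_normc cD).
have iD : mu.-integrable Om (EFin \o (fun x => normc (D x) ^+ 2)).
  by apply: (rcont_integrable mu_leb); under eq_fun do rewrite expr2; exact: rD.
(* The comparison is pointwise: [|D + V|^2] is at least [|D|^2 + 2 Re (D conj V)], whose second term
   integrates to 0. *)
have [ic ec] := integrable_comb 1 2 iD ir.
have iT : mu.-integrable Om (EFin \o (fun x => normc (F x - S t x) ^+ 2)).
  have cT := rcont_normc (ccontB cF (cS t)).
  by apply: (rcont_integrable mu_leb); under eq_fun do rewrite expr2; exact: (rcontM cT cT).
have Re0 : \int[mu]_(x in Om) complex.Re (D x * (V x)^*%C) = 0 by move/(congr1 (@complex.Re _)): DV.
rewrite Re0 mul1r mulr0 addr0 in ec; rewrite -[leLHS]ec.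
apply: le_Rintegral => // x _.
have -> : F x - S t x = D x + V x.
  rewrite /D /V /S -addrA; congr (_ + _); rewrite -!sumrN -big_split; apply: eq_bigr => k _ /=.
  by ring.
rewrite !normc_sqr; move: (D x) (V x) => [p q] [r s] /=.
by have := sqr_ge0 r; have := sqr_ge0 s; nra.
Qed.

End FourierSystem.

(** * The Fejér kernel sampled on a finite grid *)

Section Fejer.
Variable R : realType.
Local Notation E := (fun t : R => expi (2 * pi * t)).

(** [cos (2 pi d) = 1] forces [sin (pi d) = 0], and sine has no zero inside (0, pi). *)
Lemma expi_eq1 (d : R) : -1 < d < 1 -> expi (2 * pi * d) = 1 -> d = 0.
Proof.
move=> /andP[d1 d2] /(congr1 (@complex.Re _)) /= c1.
have s0 : sin (pi * d) = 0.
  apply/eqP; rewrite -sqrf_eq0; apply/eqP.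
  have := cos2Dsin2 (pi * d); have : cos (pi * d + pi * d) = 1.
    by rewrite -c1; congr cos; ring.
  by rewrite cosD -!expr2; lra.
have pos (t : R) : 0 < t < 1 -> sin (pi * t) != 0.
  move=> /andP[t0 t1]; rewrite gt_eqF// sin_gt0_pi// mulr_gt0 ?pi_gt0//=.
  by rewrite -[ltRHS]mulr1 ltr_pM2l ?pi_gt0.
have [dlt|dgt|//] := ltgtP d 0.
  have : sin (pi * - d) != 0 by apply: pos; rewrite oppr_gt0 dlt ltrNl.
  by rewrite mulrN sinN s0 oppr0 eqxx.
by have := pos d; rewrite s0 eqxx dgt d2 => /(_ isT).
Qed.

(** Equidistant quadrature with [M] points is exact for frequencies below [M]: for [d] nonzero this
    is a geometric sum whose ratio is an [M]-th root of unity, different from 1 since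
    [|d / M| < 1]. *)
Lemma sum_grid (M : nat) (d : int) (t : R) : (`|d| < M)%N ->
  \sum_(c < M) E (d%:~R * (t - c%:R / M%:R)) = if d == 0 then M%:R else 0.
Proof.
move=> dM; have [->|d0] := eqVneq d 0.
  under eq_bigr do rewrite mul0r mulr0 expi0.
  by rewrite sumr_const card_ord.
have M0 : M%:R != 0 :> R by rewrite pnatr_eq0; lia.
pose q := E (- (d%:~R / M%:R)).
have qE (c : nat) : E (d%:~R * (t - c%:R / M%:R)) = E (d%:~R * t) * q ^+ c.
  have qc : q ^+ c = E (- (d%:~R * (c%:R / M%:R))).
    elim: c => [|c IH]; first by rewrite expr0 mul0r mulr0 oppr0 mulr0 expi0.
    by rewrite exprS IH -expiD -[c.+1%:R]natr1; congr expi; ring.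
  by rewrite qc -expiD; congr expi; ring.
under eq_bigr do rewrite qE.
rewrite -mulr_sumr; apply/eqP; rewrite mulf_eq0; apply/orP; right.
have qM : q ^+ M = 1.
  have := qE M; rewrite divff// mulrBr mulr1 => H.
  have Ed : E (- (d%:~R)) = 1 by rewrite -mulrNz expi2pi.
  have E0 : E (d%:~R * t) != 0.
    by rewrite -normc_eq0 normc_expi oner_eq0.
  apply: (mulfI E0); rewrite -H mulr1 -[RHS]mulr1 -Ed -expiD; congr expi; ring.
have q1 : q != 1.
  have nd : `|- (d%:~R / M%:R)| < 1 :> R.
    rewrite normrN normrM normfV ltr_pdivrMr ?normr_gt0// mul1r.
    by rewrite normr_nat -intr_norm -abszE -[ltRHS]/((M%:Z)%:~R) ltr_int ltz_nat.
  rewrite ltr_norml in nd.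
  apply/eqP => /(expi_eq1 nd)/eqP.
  by rewrite oppr_eq0 mulf_eq0 invr_eq0 (negPf M0) intr_eq0 (negPf d0).
have := subrX1 q M; rewrite qM subrr => /esym/eqP.
by rewrite mulf_eq0 subr_eq0 (negPf q1).
Qed.

Definition Dir (N : nat) (t : R) : R[i] := \sum_(a < N.+1) E (a%:R * t).

Lemma conj_Dir N t : (Dir N t)^*%C = \sum_(a < N.+1) E (- (a%:R * t)).
Proof. by rewrite /Dir rmorph_sum; apply: eq_bigr => a _; rewrite mulrN expiN. Qed.

(** [Dir] is a one-sided Dirichlet sum, so [|Dir|^2 / (N + 1)] is the Fejér kernel; the further
    factor [N + 2], the number of grid points, makes the values on the grid sum to 1. *)
Definition fejer (N : nat) (t : R) : R := normc (Dir N t) ^+ 2 / (N.+1%:R * N.+2%:R).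

Lemma fejer_ge0 N t : 0 <= fejer N t.
Proof. by rewrite divr_ge0 ?exprn_ge0 ?normc_ge0 ?mulr_ge0. Qed.

Lemma normc_sqrC (z : R[i]) : (normc z ^+ 2)%:C = z * z^*%C.
Proof. by rewrite rmorphXn /= -sqr_normc. Qed.

Lemma fejerE N t : (fejer N t)%:C =
  (N.+1%:R * N.+2%:R)^-1%:C *
  \sum_(a < N.+1) \sum_(b < N.+1) E ((a%:Z - b%:Z)%:~R * t).
Proof.
rewrite /fejer rmorphM /= normc_sqrC mulrC; congr (_ * _).
rewrite conj_Dir /Dir mulr_suml; apply: eq_bigr => a _.
rewrite mulr_sumr; apply: eq_bigr => b _.
by rewrite -expiD intrB; congr expi; ring.
Qed.

(** [e = false] gives the mass of the kernel and [e = true] its first Fourier coefficient. The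
    frequencies [a - b + e] are at most [N + 1] in absolute value, hence the grid of [N + 2]
    points. *)
Lemma sum_fejer_exp N (t : R) (e : bool) :
  \sum_(c < N.+2) (fejer N (t - c%:R / N.+2%:R))%:C *
      E ((e : nat)%:R * (t - c%:R / N.+2%:R)) =
  (\sum_(a < N.+1) \sum_(b < N.+1) ((a + e)%N == b :> nat)%:R) / N.+1%:R.
Proof.
have inner (a b : 'I_N.+1) :
    \sum_(c < N.+2) E ((a%:Z - b%:Z + (e : nat)%:Z)%:~R * (t - c%:R / N.+2%:R)) =
    N.+2%:R * ((a + e)%N == b :> nat)%:R.
  rewrite sum_grid; last by case: a b e => [a +] [b +] []/=; lia.
  have -> : (a%:Z - b%:Z + (e : nat)%:Z == 0) = ((a + e)%N == b :> nat) by lia.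
  by case: (_ == _); rewrite ?mulr1 ?mulr0.
transitivity ((N.+1%:R * N.+2%:R)^-1%:C * \sum_(a < N.+1) \sum_(b < N.+1)
    (N.+2%:R * ((a + e)%N == b :> nat)%:R) : R[i]).
  under [in RHS]eq_bigr do under eq_bigr do rewrite -inner.
  rewrite [in RHS](eq_bigr _ (fun a _ => exchange_big _ _ _ _ _ _)) /= exchange_big /= mulr_sumr.
  apply: eq_bigr => c _; rewrite fejerE -mulrA; congr (_ * _).
  rewrite mulr_suml; apply: eq_bigr => a _; rewrite mulr_suml; apply: eq_bigr => b _.
  by rewrite -expiD; congr expi; rewrite intrD; ring.
under eq_bigr do rewrite -mulr_sumr.
rewrite -mulr_sumr mulrA mulrC; congr (_ * _).
rewrite -[N.+2%:R]/(1 *+ N.+2) -(rmorph_nat (real_complex R)) -rmorphM invfM -mulrA.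
by rewrite mulVf ?pnatr_eq0// mulr1 fmorphV rmorph_nat.
Qed.

Lemma sum_fejer N (t : R) : \sum_(c < N.+2) fejer N (t - c%:R / N.+2%:R) = 1.
Proof.
apply: complexI; rewrite rmorph_sum.
have := sum_fejer_exp N t false.
under eq_bigr do rewrite mul0r mulr0 expi0 mulr1.
move=> ->; under eq_bigr => a _.
  rewrite (bigD1 a) //= addn0 eqxx big1 ?addr0; first over.
  by move=> b ba; rewrite (_ : (_ == _) = false)//; apply/negbTE; rewrite eq_sym.
by rewrite sumr_const card_ord divff ?pnatr_eq0.
Qed.

Lemma sum_fejer_cos N (t : R) :
  \sum_(c < N.+2) fejer N (t - c%:R / N.+2%:R) * (1 - cos (2 * pi * (t - c%:R / N.+2%:R))) =
  N.+1%:R^-1.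
Proof.
under eq_bigr do rewrite mulrBr mulr1.
rewrite sumrB sum_fejer.
have := sum_fejer_exp N t true.
have -> : \sum_(a < N.+1) \sum_(b < N.+1) ((a + true)%N == b :> nat)%:R = N%:R :> R[i].
  (* The row [a = N] has no [b = a + 1] in range; each of the other [N] rows contributes 1, so the
     first coefficient is [N / (N + 1)]. *)
  rewrite big_ord_recr /= [X in _ + X]big1 ?addr0; last first.
    by move=> b _; rewrite (_ : (_ == _) = false)//; have := ltn_ord b; lia.
  under eq_bigr => a _.
    have aN : ((a + true)%N < N.+1)%N by have := ltn_ord a; lia.
    rewrite (bigD1 (Ordinal aN)) //= eqxx big1 ?addr0; first over.
    by move=> b ba; rewrite (_ : (_ == _) = false)//; apply/negbTE; rewrite eq_sym.
  by rewrite sumr_const card_ord.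
move=> /(congr1 (@complex.Re _)); rewrite Re_sum.
under eq_bigr do rewrite mul1r ReM /= mul0r subr0.
move=> ->; rewrite -!(rmorph_nat (real_complex R)) -fmorphV -rmorphM /=.
have N0 : N.+1%:R != 0 :> R by rewrite pnatr_eq0.
by rewrite -{1}(divff N0) -mulrBl -natr1 addrAC subrr add0r mul1r.
Qed.

End Fejer.

(** * Trigonometric polynomials *)

Section TrigPolynomials.
Variables (R : realType) (n : nat).
Local Notation Pt := (Pt R n).
Local Notation CFun := (CFun R n).
Local Notation Zn := (n.-tuple int).
Implicit Types (f g F : CFun) (xi eta : Zn).

(** Frequencies may repeat in the list, so a sum is a concatenation and a product is the list of all
    pairs. *)
Definition trig f : Prop := exists s : seq (R[i] * Zn),
  forall x, f x = \sum_(p <- s) p.1 * Exp (freq R p.2) x.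

Lemma eq_trig f g : f =1 g -> trig f -> trig g.
Proof. by move=> fg [s sE]; exists s => x; rewrite -fg. Qed.

Lemma trig_Exp (a : R[i]) xi : trig (fun x => a * Exp (freq R xi) x).
Proof. by exists [:: (a, xi)] => x; rewrite big_seq1. Qed.

Lemma trigD f g : trig f -> trig g -> trig (fun x => f x + g x).
Proof. by move=> [s sE] [t tE]; exists (s ++ t) => x; rewrite big_cat /= sE tE. Qed.

Lemma trigM f g : trig f -> trig g -> trig (fun x => f x * g x).
Proof.
move=> [s sE] [t tE].
exists [seq (p.1 * q.1, tadd p.2 q.2) | p <- s, q <- t] => x.
rewrite sE tE mulr_suml big_allpairs_dep; apply: eq_bigr => p _.
rewrite mulr_sumr; apply: eq_bigr => q _.
by rewrite /= freqD ExpD; ring.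
Qed.

Lemma freq0 : freq R ([tuple 0 | i < n] : Zn) = (fun=> 0).
Proof.
by apply: funext => j; rewrite /freq tnth_mktuple mulr0.
Qed.

Lemma trig_cst (a : R[i]) : trig (fun=> a).
Proof.
apply: eq_trig (trig_Exp a [tuple 0 | i < n]) => x.
by rewrite freq0 Exp0 mulr1.
Qed.

Lemma trigZ (a : R[i]) f : trig f -> trig (fun x => a * f x).
Proof. by move=> tf; apply: trigM => //; exact: trig_cst. Qed.

Lemma trig_sum I (s : seq I) (f : I -> CFun) :
  (forall i, trig (f i)) -> trig (fun x => \sum_(i <- s) f i x).
Proof.
move=> tf; elim: s => [|i s IH].
  by apply: eq_trig (trig_cst 0) => x; rewrite big_nil.
by apply: eq_trig (trigD (tf i) IH) => x; rewrite big_cons.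
Qed.

Lemma trig_prod I (s : seq I) (f : I -> CFun) :
  (forall i, trig (f i)) -> trig (fun x => \prod_(i <- s) f i x).
Proof.
move=> tf; elim: s => [|i s IH].
  by apply: eq_trig (trig_cst 1) => x; rewrite big_nil.
by apply: eq_trig (trigM (tf i) IH) => x; rewrite big_cons.
Qed.

Lemma trig_coord (j : 'I_n) (d : int) (a : R) :
  trig (fun x => expi (2 * pi * (d%:~R * (tnth x j - a)))).
Proof.
pose xi : Zn := [tuple if i == j then d else 0 | i < n].
apply: eq_trig (trig_Exp (expi (- (2 * pi * (d%:~R * a)))) xi) => x.
have -> : Exp (freq R xi) x = expi (2 * pi * (d%:~R * tnth x j)).
  rewrite /Exp (bigD1 j)//= big1 ?mulr1.
    by rewrite /cexp /= mul0r expR0 mul1r tnth_mktuple eqxx mulrA.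
  move=> i /negPf ij; rewrite /freq tnth_mktuple ij mulr0; exact: cexp0.
by rewrite -expiD; congr expi; ring.
Qed.

Lemma trig_fejer N (j : 'I_n) (a : R) : trig (fun x => (fejer N (tnth x j - a))%:C).
Proof.
have E : (fun x : Pt => (N.+1%:R * N.+2%:R)^-1%:C *
  \sum_(a0 < N.+1) \sum_(b < N.+1) expi (2 * pi * ((a0%:Z - b%:Z)%:~R * (tnth x j - a))))
  =1 (fun x => (fejer N (tnth x j - a))%:C) by move=> x; rewrite fejerE.
apply: eq_trig E _; apply: trigZ; apply: trig_sum => k; apply: trig_sum => l.
exact: trig_coord.
Qed.

(** Passage from frequency lists to the enumeration, the form in which [best_approx] takes its
    competitors. *)
Lemma trig_fexp f : trig f -> exists N (t : nat -> R[i]),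
  forall x, f x = \sum_(k < N) t k * fexp k x.
Proof.
move=> [s sE]; have : exists N (t : nat -> R[i]),
    forall x, \sum_(p <- s) p.1 * Exp (freq R p.2) x = \sum_(k < N) t k * fexp k x.
  elim: s {f sE} => [|[a xi] s [N [t tE]]].
    by exists 0%N, (fun=> 0) => x; rewrite big_nil big_ord0.
  pose m := pickle xi; pose M := maxn N m.+1.
  exists M, (fun k => (if (k < N)%N then t k else 0) + (if k == m then a else 0)) => x.
  rewrite big_cons tE; under [RHS]eq_bigr do rewrite mulrDl; rewrite big_split /= [LHS]addrC.
  congr (_ + _).
    have := @big_ord_widen _ 0 (@GRing.add R[i]) N M (fun k => t k * fexp k x) (leq_maxl _ _).
    move=> /= ->; rewrite big_mkcond.
    by apply: eq_bigr => k _; case: ifP; rewrite ?mul0r.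
  have mM : (m < M)%N by rewrite leq_maxr.
  rewrite (bigD1 (Ordinal mM)) //= eqxx /fexp /at_freq pickleK_inv big1 ?addr0// => k km.
  by rewrite (_ : (_ == _) = false) ?mul0r//; apply/negbTE.
by move=> [N [t tE]]; exists N, t => x; rewrite sE.
Qed.

End TrigPolynomials.

(** * Uniform density of trigonometric polynomials among continuous periodic functions *)

Section Density.
Variables (R : realType) (n : nat).
Local Notation Pt := (Pt R n).
Local Notation CFun := (CFun R n).
Variable F : CFun.
Hypothesis cF : ccontinuous F.
Hypothesis perF : forall j y, Omega y -> F (upd y j 0) = F (upd y j 1).

(** Periodicity is assumed over interior points only; continuity extends it to the closed faces,
    including edges and corners. *)
Lemma per_cube j y : cube y -> F (upd y j 0) = F (upd y j 1).
Proof.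
move=> cy; apply/eqP; rewrite -subr_eq0 -normc_eq0 eq_le normc_ge0 andbT leNgt.
apply/negP; set e := normc _ => e0; have e20 : 0 < e / 2 by rewrite divr_gt0.
have [d d0 H0] := cF (upd y j 0) e20; have [d' d'0 H1] := cF (upd y j 1) e20.
pose s := Order.min 1 (Order.min d d').
have s0 : 0 < s by rewrite !lt_min ltr01 d0.
have s1 : s <= 1 by rewrite ge_min lexx.
have sd : s <= d by rewrite !ge_min lexx !orbT.
have sd' : s <= d' by rewrite !ge_min lexx !orbT.
(* The convex combination of [y] and the centre of the cube with weight [s] on the centre: interior,
   and closer than [s] to [y] in each coordinate. *)
pose z : Pt := [tuple (1 - s) * tnth y i + s / 2 | i < n].
have Oz : Omega z.
  move=> i; rewrite tnth_mktuple; have /andP[a b] := cy i.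
  have a' : 0 <= (1 - s) * tnth y i by rewrite mulr_ge0// subr_ge0.
  have b' : (1 - s) * tnth y i <= 1 - s by rewrite ler_piMr// subr_ge0.
  by apply/andP; split; lra.
have zy i : `|tnth z i - tnth y i| < s.
  rewrite tnth_mktuple; have /andP[a b] := cy i.
  have -> : (1 - s) * tnth y i + s / 2 - tnth y i = s * (2^-1 - tnth y i) by ring.
  rewrite normrM gtr0_norm// gtr_pMr// ltr_norml; apply/andP; split; lra.
have zy' t d1 : 0 < d1 -> s <= d1 -> forall i, `|tnth (upd z j t) i - tnth (upd y j t) i| < d1.
  move=> d10 sd1 i; rewrite !tnth_upd; case: eqP => _; first by rewrite subrr normr0.
  exact: lt_le_trans (zy i) sd1.
have h0 := H0 _ (zy' 0 _ d0 sd); have h1 := H1 _ (zy' 1 _ d'0 sd').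
have := ler_normcD (F (upd y j 0) - F (upd z j 0)) (F (upd z j 1) - F (upd y j 1)).
rewrite (perF j Oz) subrKA -/e (normc_subC (F (upd y j 0))) => h2.
by rewrite (perF j Oz) in h0; lra.
Qed.

(** Each term must vanish, so each [x_i - y_i] is 0, 1 or -1, and in the last two cases the
    coordinates are 0 and 1 in some order. Coordinates of [x] are then replaced by those of [y] one
    at a time, by periodicity. *)
Lemma torus_eq x y : cube x -> cube y ->
  \sum_i (1 - cos (2 * pi * (tnth x i - tnth y i))) = 0 -> F x = F y.
Proof.
move=> cx cy /eqP; rewrite psumr_eq0; last by move=> i _; rewrite subr_ge0 cos_le1.
move=> /allP H.
have xy i : tnth x i = tnth y i \/ (tnth x i = 0 /\ tnth y i = 1) \/ (tnth x i = 1 /\ tnth y i = 0).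
  have := H i; rewrite mem_index_enum => /(_ isT) /implyP/(_ isT).
  rewrite subr_eq0 => /eqP c1.
  have /andP[x0 x1] := cx i; have /andP[y0 y1] := cy i.
  have E1 : expi (2 * pi * (tnth x i - tnth y i)) = 1.
    apply: complexP => //=; apply/eqP; rewrite -sqrf_eq0; apply/eqP.
    by have := cos2Dsin2 (2 * pi * (tnth x i - tnth y i)); rewrite -c1; lra.
  have [lt|ge] := ltP (tnth x i - tnth y i) 1; last first.
    by right; right; split; lra.
  have [lt'|ge'] := ltP (-1) (tnth x i - tnth y i); last first.
    by right; left; split; lra.
  left; apply/eqP; rewrite -subr_eq0; apply/eqP; apply: expi_eq1 E1.
  by rewrite lt' lt.
pose mix k : Pt := [tuple if (i < k)%N then tnth y i else tnth x i | i < n].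
have cmix k : cube (mix k) by move=> i; rewrite tnth_mktuple; case: ifP.
have step (k : 'I_n) : F (mix k) = F (mix k.+1).
  have E0 : mix k = upd (mix k) k (tnth x k).
    apply: eq_from_tnth => i; rewrite tnth_upd; case: eqP => // ->.
    by rewrite tnth_mktuple ltnn.
  have E1 : mix k.+1 = upd (mix k) k (tnth y k).
    apply: eq_from_tnth => i; rewrite tnth_upd !tnth_mktuple ltnS leq_eqVlt.
    by case: eqP => [ik|/eqP/negPf ik]; [rewrite (val_inj ik) eqxx|rewrite -val_eqE ik].
  rewrite E0 E1; have [->//|[[-> ->]|[-> ->]]] := xy k.
    exact: per_cube.
  by rewrite per_cube.
have mixE k : (k <= n)%N -> F x = F (mix k).
  elim: k => [_|k IH kn].
    by congr F; apply: eq_from_tnth => i; rewrite tnth_mktuple.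
  by rewrite (IH (ltnW kn)) (step (Ordinal kn)).
rewrite (mixE n)//; congr F; apply: eq_from_tnth => i.
by rewrite tnth_mktuple ltn_ord.
Qed.

Lemma torus_modulus e : 0 < e -> exists2 C : R, 0 <= C &
  forall x y, cube x -> cube y ->
    normc (F x - F y) <= e + C * \sum_i (1 - cos (2 * pi * (tnth x i - tnth y i))).
Proof.
apply: (cube_modulus cF).
- apply: (@continuous_sum_coord R n (fun t => 1 - cos (2 * pi * t))) => t.
  have cc : {for t, continuous (cos \o (fun t : R => 2 * pi * t))}.
    apply: continuous_comp; [exact: mulrl_continuous|exact: continuous_cos].
  exact: (continuousB (@cst_continuous _ _ (1 : R) t) cc).
- by move=> x y; apply: sumr_ge0 => i _; rewrite subr_ge0 cos_le1.
- exact: torus_eq.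
Qed.

(* Korovkin: the discrete Fejer operator is positive, preserves constants and
   averages [1 - cos (2 pi (x_i - .))], which vanishes only on the diagonal of
   the torus, to [1 / (N + 1)]. *)
Lemma trig_dense e : 0 < e -> exists2 T : CFun, trig T &
  forall x, cube x -> normc (F x - T x) <= e.
Proof.
move=> e0; have e20 : 0 < e / 2 by lra.
have [C C0 HC] := torus_modulus e20.
(* Each coordinate contributes [1 / (N + 1)] to the averaged modulus, so [C n / (N + 1)] has to be
   at most [e / 2]. *)
pose N := Num.trunc (C * n%:R / (e / 2)).
have N1 : C * (n%:R / N.+1%:R) <= e / 2.
  rewrite mulrA ler_pdivrMr// [leRHS]mulrC -ler_pdivrMr//.
  have x0 : 0 <= C * n%:R / (e / 2) by rewrite divr_ge0 ?mulr_ge0// ltW.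
  by have /andP[_ /ltW] := trunc_itv x0.
pose gp (c : {ffun 'I_n -> 'I_N.+2}) : Pt := [tuple (c i)%:R / N.+2%:R | i < n].
have cgp c : cube (gp c).
  move=> i; rewrite tnth_mktuple divr_ge0//= ler_pdivrMr// mul1r ler_nat.
  exact: ltnW.
pose K (c : {ffun 'I_n -> 'I_N.+2}) (x : Pt) := \prod_i fejer N (tnth x i - (c i)%:R / N.+2%:R).
have K0 c x : 0 <= K c x by apply: prodr_ge0 => i _; exact: fejer_ge0.
have sumK x : \sum_c K c x = 1.
  rewrite -(bigA_distr_bigA (fun i (c : 'I_N.+2) => fejer N (tnth x i - c%:R / N.+2%:R))) /=.
  by rewrite big1// => i _; rewrite sum_fejer.
have sumKc x (i : 'I_n) :
    \sum_c K c x * (1 - cos (2 * pi * (tnth x i - (c i)%:R / N.+2%:R))) = N.+1%:R^-1.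
  (* The cosine factor sits in coordinate [i] alone, so the sum over the grid factors: coordinate
     [i] gives [1 / (N + 1)], the others give 1. *)
  pose G (l : 'I_n) (c : 'I_N.+2) := fejer N (tnth x l - c%:R / N.+2%:R) *
     (if l == i then 1 - cos (2 * pi * (tnth x l - c%:R / N.+2%:R)) else 1).
  transitivity (\sum_(c : {ffun 'I_n -> 'I_N.+2}) \prod_l G l (c l)).
    apply: eq_bigr => c _; rewrite /G big_split /=; congr (_ * _).
    by rewrite -big_mkcond /= big_pred1_eq.
  rewrite -(bigA_distr_bigA G) /= (bigD1 i)//= [X in _ * X]big1.
    rewrite mulr1 -[RHS](sum_fejer_cos N (tnth x i)); apply: eq_bigr => c _.
    by rewrite /G eqxx.
  move=> l /negPf li; rewrite -[RHS](sum_fejer N (tnth x l)); apply: eq_bigr => c _.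
  by rewrite /G li mulr1.
exists (fun x => \sum_c F (gp c) * (K c x)%:C).
  apply: trig_sum => c; apply: trigZ.
  have E : (fun x : Pt => \prod_i (fejer N (tnth x i - (c i)%:R / N.+2%:R))%:C) =1
      (fun x => (K c x)%:C) by move=> x; rewrite rmorph_prod.
  by apply: eq_trig E _; apply: trig_prod => i; exact: trig_fejer.
move=> x cx.
have -> : F x - \sum_c F (gp c) * (K c x)%:C = \sum_c (K c x)%:C * (F x - F (gp c)).
  under [RHS]eq_bigr do rewrite mulrBr.
  rewrite sumrB -mulr_suml -rmorph_sum sumK mul1r; congr (_ - _).
  by apply: eq_bigr => c _; rewrite mulrC.
apply: le_trans (normc_sum _ _ _) _.
apply: (@le_trans _ _ (\sum_c (K c x * (e / 2) + C * \sum_i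
    K c x * (1 - cos (2 * pi * (tnth x i - (c i)%:R / N.+2%:R)))))).
  apply: ler_sum => c _; rewrite normc_mul normcC ger0_norm ?K0//.
  apply: le_trans (ler_wpM2l (K0 c x) (HC x (gp c) cx (cgp c))) _.
  rewrite mulrDr lerD2l mulrCA ler_wpM2l// mulr_sumr; apply: ler_sum => i _.
  by rewrite tnth_mktuple.
rewrite big_split /= -mulr_suml sumK mul1r -mulr_sumr exchange_big /=.
under eq_bigr do rewrite sumKc.
rewrite sumr_const card_ord [leRHS](splitr e) lerD2l.
by rewrite -[X in C * X]mulr_natl.
Qed.

End Density.

(** * Eigenfunctions of L_h, coefficients and partial sums *)

Section Laplacian.
Variables (R : realType) (n : nat) (h : n.-tuple R).
Hypothesis h_pos : forall j : 'I_n, 0 < tnth h j.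
Local Notation Pt := (Pt R n).
Local Notation CFun := (CFun R n).
Local Notation Om := (@Omega R n).
Local Notation Zn := (n.-tuple int).
Implicit Types (f g : CFun) (xi : Zn) (x : Pt).

Definition hexp (j : 'I_n) : R[i] := (ln (tnth h j))%:C.
Definition uexp xi (j : 'I_n) : R[i] := hexp j + freq R xi j.
(** This is [1 / u_xi], the conjugate of [v_xi]; pairing with it without conjugation gives the
    L_h-Fourier coefficient. *)
Definition wexp xi : CFun := Exp (fun j => - uexp xi j).

Lemma u_xiE xi : u_xi h xi = Exp (uexp xi).
Proof.
apply: funext => x; rewrite /u_xi /uexp ExpD; congr (_ * _).
  rewrite rmorph_prod /Exp; apply: eq_bigr => j _.
  rewrite /cexp /= mul0r expi0 mulr1 /powR gt_eqF ?h_pos//.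
  by rewrite mulrC.
rewrite /Exp mulr_sumr; elim/big_ind2 : _ => [|a b c d <- <-|j _].
- by rewrite expi0.
- by rewrite expiD.
- by rewrite /cexp /= mul0r expR0 mul1r mulrA.
Qed.

Lemma uexp_wexp xi x : Exp (uexp xi) x * wexp xi x = 1.
Proof.
rewrite /wexp -ExpD -(Exp0 x); congr (Exp _ x).
by apply: funext => j; rewrite subrr.
Qed.

Lemma wexpE xi x : wexp xi x = Exp (fun j => - hexp j) x * (Exp (freq R xi) x)^*%C.
Proof.
rewrite conj_Exp_freq freqN -ExpD; congr (Exp _ x).
by apply: funext => j; rewrite /uexp opprD.
Qed.

Lemma cexp_uexp1 xi j : cexp (uexp xi j) 1 = (tnth h j)%:C.
Proof.
rewrite cexpDl cexp_freq1 mulr1 /cexp /= mul0r expi0 !mulr1.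
by rewrite lnK ?posrE.
Qed.

Lemma cexp_wexp1 xi j : cexp (- uexp xi j) 1 = (tnth h j)^-1%:C.
Proof.
have h0 : (tnth h j)%:C != 0 by rewrite eq_complex /= eqxx andbT gt_eqF.
apply: (mulfI h0); rewrite -rmorphM /= divff ?gt_eqF// -(cexp_uexp1 xi) -cexpDl subrr.
exact: cexp0.
Qed.

Lemma CinfLh_Exp xi : CinfLh h (Exp (uexp xi)).
Proof.
split=> [|k]; first exact: smooth_Exp.
rewrite lapk_Exp => j y _.
rewrite (is_pd_pdC (is_pdZ _ (is_pd_Exp _ j))) (Exp_upd _ _ _ 1) cexp_uexp1.
by split; ring.
Qed.

Lemma ccont_wexp xi : ccontinuous (wexp xi).
Proof. exact: ccont_Exp. Qed.

(** The modulus of [w_xi] is [h^{-x}] for every [xi], so the bound depends on [h] alone; adding 1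
    makes it positive. *)
Lemma wexp_bounded : exists2 B : R, 0 < B & forall xi x, cube x -> normc (wexp xi x) <= B.
Proof.
have [B B0 HB] := cube_bounded (@ccont_Exp R n (fun j => - hexp j)).
exists (B + 1) => [|xi x /HB Bx]; first by lra.
rewrite wexpE normc_mul conj_Exp_freq normc_Exp_freq mulr1; lra.
Qed.

Lemma Exp_uexp_normc xi x : normc (Exp (uexp xi) x) = normc (Exp hexp x).
Proof. by rewrite /uexp ExpD normc_mul normc_Exp_freq mulr1. Qed.

Lemma uexp_bounded : exists2 B : R, 0 < B & forall xi x, cube x -> normc (Exp (uexp xi) x) <= B.
Proof.
have [B B0 HB] := cube_bounded (@ccont_Exp R n hexp).
exists (B + 1) => [|xi x /HB Bx]; first by lra.
rewrite Exp_uexp_normc; lra.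
Qed.

Definition us (k : nat) : CFun := at_freq (fun=> 0) (fun xi => Exp (uexp xi)) k.

Lemma CinfLh_us k : CinfLh h (us k).
Proof.
rewrite /us /at_freq; case: pickle_inv => [xi|]; [exact: CinfLh_Exp|exact: CinfLh0].
Qed.

Variable mu : {measure set Pt -> \bar R}.
Hypothesis mu_leb : is_lebesgue mu.
Local Notation Cint := (Cint mu).

Definition hat f xi : R[i] := Cint (fun x => f x * wexp xi x).
Definition hatk f k : R[i] := at_freq 0 (hat f) k.
(** The eigenvalue of the Laplacian on [u_xi]. *)
Definition lambda xi : R[i] := \sum_j uexp xi j ^+ 2.

(* Green's identity in one variable: the boundary conditions make
   [d_j f w - f d_j w] periodic in [x_j]. *)
Lemma hat_pd2 f xi j : CinfLh h f ->
  Cint (fun x => pdC j (pdC j f) x * wexp xi x) = uexp xi j ^+ 2 * hat f xi.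
Proof.
move=> [sf bf]; set c := uexp xi j.
have dw := is_pd_Exp (fun j => - uexp xi j) j; rewrite -/(wexp xi) in dw.
have df := smooth_pd j sf; have d2f := smooth_pd j (smooth_pdC j sf).
have cf := smooth_cont sf; have cd2f := smooth_cont (smooth_pdC j (smooth_pdC j sf)).
have cw := ccont_wexp xi.
(* Since [d_j w = - c w], the function differentiated here, [d_j f w + c f w], is
   [d_j f w - f d_j w]; the cross terms cancel in [E]. *)
have dG := is_pdD (is_pdM d2f dw) (is_pdZ c (is_pdM df dw)).
have E x : pdC j (pdC j f) x * wexp xi x + pdC j f x * (- uexp xi j * wexp xi x) +
      c * (pdC j f x * wexp xi x + f x * (- uexp xi j * wexp xi x)) =
    pdC j (pdC j f) x * wexp xi x - c ^+ 2 * (f x * wexp xi x).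
  by rewrite -/c; ring.
have c1 := ccontM cd2f cw; have c2 := ccontM cf cw.
have cg : ccontinuous (fun x => pdC j (pdC j f) x * wexp xi x - c ^+ 2 * (f x * wexp xi x)).
  exact: (ccontB c1 (ccontZ _ c2)).
have := @Cint_pd0 _ _ _ mu_leb j _ _ dG; rewrite (funext E) => /(_ cg).
rewrite CintB; [|exact: ccont_integrable|by apply: cintegrableZ; exact: ccont_integrable].
rewrite CintZ; last exact: ccont_integrable.
move=> H; apply/eqP; rewrite -subr_eq0; apply/eqP; apply: H => y Oy.
(* Between the faces [f] and [d_j f] gain the factor [h_j] while [w] gains [1 / h_j]. *)
have [b0 b1] := bf 0%N j y Oy; rewrite /= in b0 b1.
rewrite -b0 -b1 /wexp (Exp_upd _ _ _ 1) cexp_wexp1.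
have h0 : (tnth h j)%:C * (tnth h j)^-1%:C = 1 by rewrite -rmorphM /= divff ?gt_eqF.
set p := pdC j f _; set q := f _; set E0 := Exp _ _; set H1 := (tnth h j)%:C in h0 *.
set H2 := (tnth h j)^-1%:C in h0 *.
have -> : H1 * p * (H2 * E0) + c * (H1 * q * (H2 * E0)) = (H1 * H2) * (p * E0 + c * (q * E0)).
  by ring.
by rewrite h0 mul1r.
Qed.

Lemma hat_lap f xi : CinfLh h f -> hat (lap f) xi = lambda xi * hat f xi.
Proof.
move=> Cf; have sf := Cf.1; rewrite /lambda mulr_suml.
under eq_bigr do rewrite -(hat_pd2 _ _ Cf).
have cc j : ccontinuous (fun x => pdC j (pdC j f) x * wexp xi x).
  exact: (ccontM (smooth_cont (smooth_pdC j (smooth_pdC j sf))) (ccont_wexp xi)).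
have := Cint_sum mu_leb (index_enum 'I_n) (fun=> 1) cc.
under [in RHS]eq_bigr do rewrite mul1r.
move=> <-; apply: eq_Cint => x _; rewrite /lap mulr_suml.
by apply: eq_bigr => j _; rewrite mul1r.
Qed.

Lemma hat_lapk f xi m : CinfLh h f -> hat (lapk m f) xi = lambda xi ^+ m * hat f xi.
Proof.
move=> Cf; elim: m => [|m IH]; first by rewrite expr0 mul1r.
have -> : lapk m.+1 f = lap (lapk m f) by [].
by rewrite hat_lap ?IH ?exprS ?mulrA//; exact: CinfLh_lapk.
Qed.

Definition Sn N f : CFun := fun x => \sum_(k < N) hatk f k * us k x.

Lemma CinfLh_Sn N f : CinfLh h (Sn N f).
Proof. by apply: CinfLh_sum => k; exact: CinfLh_us. Qed.

(** Both sides acquire the factor [lambda xi ^+ m]: the left from the eigenfunctions, the right from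
    the coefficients by Green's identity. *)
Lemma lapk_Sn N f m : CinfLh h f -> lapk m (Sn N f) = Sn N (lapk m f).
Proof.
move=> Cf; rewrite lapk_sum; last by move=> k; exact: (CinfLh_us k).1.
apply: funext => x; apply: eq_bigr => k _; rewrite /hatk /us /at_freq.
case: pickle_inv => [xi|]; last by rewrite !mul0r.
by rewrite hat_lapk// lapk_Exp /lambda; ring.
Qed.

(** Division by [h^x] makes [f] periodic and turns [Sn N f] into [h^x] times the ordinary Fourier
    partial sum. *)
Let wt f : CFun := fun x => f x * Exp (fun j => - hexp j) x.

Let fcoef_wt f k : fcoef mu (wt f) k = hatk f k.
Proof.
rewrite /hatk /at_freq; case E : pickle_inv => [xi|]; last by rewrite fcoef_none.
apply: eq_Cint => x _; rewrite /fexp /at_freq E wexpE /wt.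
by rewrite mulrA.
Qed.

Let us_fexp k x : us k x = Exp hexp x * fexp k x.
Proof.
rewrite /us /fexp /at_freq; case: pickle_inv => [xi|]; last by rewrite mulr0.
by rewrite /uexp ExpD.
Qed.

Let Exp_hexpN x : Exp hexp x * Exp (fun j => - hexp j) x = 1.
Proof.
rewrite -ExpD -(Exp0 x); congr (Exp _ x).
by apply: funext => j; rewrite subrr.
Qed.

Let sub_Sn f N x : f x - Sn N f x =
  Exp hexp x * (wt f x - \sum_(k < N) fcoef mu (wt f) k * fexp k x).
Proof.
rewrite mulrBr mulrCA Exp_hexpN mulr1; congr (_ - _).
rewrite mulr_sumr; apply: eq_bigr => k _; rewrite fcoef_wt us_fexp; ring.
Qed.

Lemma rcont_normc2 f : ccontinuous f -> rcont (fun x => normc (f x) ^+ 2).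
Proof.
move=> cf; under eq_fun do rewrite expr2.
exact (rcontM (rcont_normc cf) (rcont_normc cf)).
Qed.

Lemma le_integral_cont (F G : Pt -> R) : rcont F -> rcont G ->
  (forall x, Omega x -> F x <= G x) ->
  \int[mu]_(x in Om) F x <= \int[mu]_(x in Om) G x.
Proof.
move=> cF cG FG; apply: le_Rintegral => //; first exact: measurable_Omega.
  exact: (rcont_integrable mu_leb cF).
exact: (rcont_integrable mu_leb cG).
Qed.

Lemma L2_conv f e : CinfLh h f -> 0 < e -> exists N0 : nat, forall N, (N0 <= N)%N ->
  \int[mu]_(x in Om) (normc (f x - Sn N f x) ^+ 2) <= e.
Proof.
move=> [sf bf] e0; have cf := smooth_cont sf.
have [B B0 HB] := cube_bounded (@ccont_Exp R n hexp).
have B20 : 0 < B ^+ 2 + 1 by rewrite ltr_wpDl ?exprn_ge0.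
(* Multiplying back by [h^x] costs at most [B ^+ 2] in the squared norm; the added 1 keeps the
   quotient defined when [B = 0]. *)
pose d := Num.sqrt (e / (B ^+ 2 + 1)).
have d2 : d ^+ 2 = e / (B ^+ 2 + 1) by rewrite sqr_sqrtr// divr_ge0// ltW.
have d0 : 0 < d by rewrite sqrtr_gt0 divr_gt0.
have cwt : ccontinuous (wt f) by exact: (ccontM cf (@ccont_Exp R n _)).
have pwt j y : Omega y -> wt f (upd y j 0) = wt f (upd y j 1).
  move=> Oy; have [b0 _] := bf 0%N j y Oy; rewrite /= in b0.
  rewrite /wt -b0 (Exp_upd _ _ _ 1).
  have -> : cexp (- hexp j) 1 = (tnth h j)^-1%:C.
    have := cexp_wexp1 [tuple 0 | i < n] j; rewrite /uexp freq0 addr0; exact.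
  have h0 : (tnth h j)%:C * (tnth h j)^-1%:C = 1 by rewrite -rmorphM /= divff ?gt_eqF.
  by rewrite mulrACA h0 mul1r.
have [T tT HT] := trig_dense cwt pwt d0.
have [N0 [t tE]] := trig_fexp tT.
exists N0 => N N0N.
(* Padding by 0 makes the same trigonometric polynomial a competitor for every [N >= N0]. *)
pose t' k := if (k < N0)%N then t k else 0.
have T'E x : T x = \sum_(k < N) t' k * fexp k x.
  rewrite tE; have := @big_ord_widen _ 0 (@GRing.add R[i]) N0 N (fun k => t k * fexp k x) N0N.
  move=> /= ->; rewrite big_mkcond; apply: eq_bigr => k _.
  by rewrite /t'; case: ifP; rewrite ?mul0r.
have := best_approx mu_leb t' N cwt.
set S := fun x => \sum_(k < N) fcoef mu (wt f) k * fexp k x.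
have cS : ccontinuous S by apply: ccont_sum => k; apply: ccontZ; exact: ccont_fexp.
have cT : ccontinuous (fun x => \sum_(k < N) t' k * fexp k x).
  by apply: ccont_sum => k; apply: ccontZ; exact: ccont_fexp.
move=> best.
have le1 : \int[mu]_(x in Om) (normc (wt f x - \sum_(k < N) t' k * fexp k x) ^+ 2) <= d ^+ 2.
  rewrite -[leRHS](Rintegral_Omega_cst mu_leb); apply: le_integral_cont.
  - exact: (rcont_normc2 (ccontB cwt cT)).
  - exact: rcont_cst.
  - move=> x /Omega_cube cx; rewrite ler_sqr ?nnegrE ?normc_ge0 ?(ltW d0)//.
    by rewrite -T'E; exact: HT.
have rs := rcont_normc2 (ccontB cwt cS).
apply: (@le_trans _ _ (\int[mu]_(x in Om) (B ^+ 2 * normc (wt f x - S x) ^+ 2))).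
  apply: le_integral_cont.
  - exact: (rcont_normc2 (ccontB cf (smooth_cont (CinfLh_Sn N f).1))).
  - exact: (rcontM (@rcont_cst R n (B ^+ 2)) rs).
  - move=> x /Omega_cube cx; rewrite sub_Sn normc_mul exprMn ler_wpM2r ?exprn_ge0 ?normc_ge0//.
    by rewrite ler_sqr ?nnegrE ?normc_ge0// HB.
rewrite RintegralZl; [|exact: measurable_Omega|exact: (rcont_integrable mu_leb rs)].
apply: (@le_trans _ _ (B ^+ 2 * d ^+ 2)).
  by rewrite ler_wpM2l ?exprn_ge0//; exact: le_trans best le1.
rewrite d2 mulrCA ger_pMr// ler_pdivrMr// mul1r; lra.
Qed.

(** * The operator: L^2 convergence of its expansion *)

Variable A : CFun -> CFun.
Hypothesis AC : forall f, CinfLh h f -> CinfLh h (A f).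
Hypothesis Alin : linear_on_Cinf h A.
Hypothesis Acont : cont_on_Cinf mu h A.

Lemma A_zero x : Omega x -> A (fun=> 0) x = 0.
Proof.
move=> Ox; have := Alin 1 (@CinfLh0 R n h) (@CinfLh0 R n h) Ox.
have -> : (fun y : Pt => 1 * 0 + 0 : R[i]) = (fun=> 0).
  by apply: funext => y; rewrite mulr0 addr0.
by rewrite mul1r -[LHS]addr0 => /addrI.
Qed.

Lemma A_sum I (s : seq I) (c : I -> R[i]) (f : I -> CFun) x :
  (forall i, CinfLh h (f i)) -> Omega x ->
  A (fun y => \sum_(i <- s) c i * f i y) x = \sum_(i <- s) c i * A (f i) x.
Proof.
move=> Cf Ox; elim: s => [|i s IH].
  under eq_fun do rewrite big_nil; rewrite big_nil; exact: A_zero.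
under eq_fun do rewrite big_cons; rewrite big_cons -IH Alin//.
exact: CinfLh_sum.
Qed.

Definition Dn f N : CFun := fun x => A f x - \sum_(k < N) hatk f k * A (us k) x.

Lemma ccont_Aus k : ccontinuous (A (us k)).
Proof. exact: smooth_cont (AC (CinfLh_us k)).1. Qed.

Lemma ccont_Dn f N : CinfLh h f -> ccontinuous (Dn f N).
Proof.
move=> Cf; apply: (ccontB (smooth_cont (AC Cf).1)).
by apply: ccont_sum => k; exact: (ccontZ _ (ccont_Aus k)).
Qed.

Lemma DnE f N x : CinfLh h f -> Omega x ->
  Dn f N x = A (fun y => -1 * Sn N f y + f y) x.
Proof.
move=> Cf Ox; rewrite Alin//; last exact: CinfLh_Sn.
rewrite /Sn A_sum//; last by move=> k; exact: CinfLh_us.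
by rewrite mulN1r addrC.
Qed.

Lemma Lpnorm2_cont f : ccontinuous f ->
  Lpnorm mu 2 f = (Num.sqrt (\int[mu]_(x in Om) (normc (f x) ^+ 2)))%:E.
Proof.
move=> cf; rewrite /Lpnorm.
have r2 := rcont_integrable mu_leb (rcont_normc2 cf).
have fi := integrable_fin_num (@measurable_Omega R n) r2.
under eq_integral do rewrite powR_mulrn ?normc_ge0//.
rewrite -[X in (X `^ _)%E](fineK fi) poweR_EFin powR12_sqrt//.
by apply: Rintegral_ge0 => x _; rewrite exprn_ge0// normc_ge0.
Qed.

Lemma A_L2_conv f e : CinfLh h f -> 0 < e -> exists N0 : nat, forall N, (N0 <= N)%N ->
  \int[mu]_(x in Om) (normc (Dn f N x) ^+ 2) <= e.
Proof.
move=> Cf e0; have [m [C [C0 HA]]] := Acont 0.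
(* The L^2 norm of the image is controlled by [m + 1] seminorms, each made at most [d], so
   [C (m + 1) d <= sqrt e]; the added 1 allows [C = 0]. *)
pose C' := C * m.+1%:R + 1.
have C'0 : 0 < C' by rewrite ltr_wpDl// mulr_ge0.
pose d := Num.sqrt e / C'.
have d0 : 0 < d by rewrite divr_gt0// sqrtr_gt0.
have /choice[N1 HN1] (j : 'I_m.+1) : exists N0 : nat, forall N, (N0 <= N)%N ->
    \int[mu]_(x in Om) (normc (lapk j f x - Sn N (lapk j f) x) ^+ 2) <= d ^+ 2.
  by apply: L2_conv; [exact: CinfLh_lapk|rewrite exprn_gt0].
exists (\max_j N1 j) => N HN.
pose g := (fun y => -1 * Sn N f y + f y).
have Cg : CinfLh h g by apply: CinfLh_lin => //; exact: CinfLh_Sn.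
have cAg := smooth_cont (AC Cg).1.
have -> : \int[mu]_(x in Om) (normc (Dn f N x) ^+ 2) = \int[mu]_(x in Om) (normc (A g x) ^+ 2).
  by apply: eq_Rintegral => x /set_mem Ox; rewrite DnE.
have := HA g Cg; rewrite (Lpnorm2_cont cAg) => H.
have le : (C%:E * \sum_(j < m.+1) Lpnorm mu 2 (lapk j g) <= (Num.sqrt e)%:E)%E.
  apply: (@le_trans _ _ (C%:E * \sum_(j < m.+1) d%:E)%E).
    apply: lee_wpmul2l; first by rewrite lee_fin.
    apply: lee_sum => j _; rewrite Lpnorm2_cont; last exact: smooth_cont (smooth_lapk j Cg.1).
    rewrite lee_fin -[leRHS](ger0_norm (ltW d0)) -sqrtr_sqr ler_wsqrtr//.
    apply: le_trans (HN1 j N (leq_trans (leq_bigmax j) HN)).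
    rewrite (lapk_lin _ _ (CinfLh_Sn N f).1 Cf.1) lapk_Sn//.
    under eq_Rintegral do rewrite mulN1r addrC.
    exact: lexx.
  rewrite sumEFin -EFinM lee_fin sumr_const card_ord -mulr_natr mulrA mulrAC.
  rewrite /d mulrA ler_pdivrMr// mulrC ler_wpM2l ?sqrtr_ge0// /C'; lra.
by move: (le_trans H le); rewrite lee_fin ler_sqrt ?(ltW e0).
Qed.

End Laplacian.

Lemma lee_poweR (R : realType) (x y : \bar R) (s : R) : (0 <= s)%R ->
  (0 <= x)%E -> (x <= y)%E -> (x `^ s <= y `^ s)%E.
Proof.
move=> s0 x0 xy; apply: gt0_ler_poweR => //; rewrite in_itv /= leey andbT//.
exact: le_trans x0 xy.
Qed.

(** * L^p norms, truncation and the passage from L^2 to L^p *)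

Section LpNorm.
Variables (R : realType) (n : nat).
Local Notation Pt := (Pt R n).
Local Notation CFun := (CFun R n).
Local Notation Om := (@Omega R n).
Variable mu : {measure set Pt -> \bar R}.
Hypothesis mu_leb : is_lebesgue mu.
Variable p : R.
Hypothesis p1 : 1 <= p.
Implicit Types (f g w : CFun).

Let p0 : 0 < p. Proof. exact: lt_le_trans ltr01 p1. Qed.

Lemma Lpnorm_ge0 f : (0 <= Lpnorm mu p f)%E.
Proof. exact: poweR_ge0. Qed.

Lemma measurable_normc_powR f : measC f ->
  measurable_fun Om (fun x => normc (f x) `^ p).
Proof. by move=> /measurable_normc mf; exact: (measurableT_comp (measurable_powR p) mf). Qed.

Let int_ge0 f : (0 <= \int[mu]_(x in Om) (normc (f x) `^ p)%:E)%E.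
Proof. by apply: integral_ge0 => x _; rewrite lee_fin powR_ge0. Qed.

Lemma Lpnorm_mono f g : measC f -> measC g ->
  (forall x, Omega x -> normc (f x) <= normc (g x)) -> (Lpnorm mu p f <= Lpnorm mu p g)%E.
Proof.
move=> mf mg fg; apply: lee_poweR; [by rewrite invr_ge0 ltW|exact: int_ge0|].
apply: ge0_le_integral => //; first exact: measurable_Omega.
- by move=> x _; rewrite lee_fin powR_ge0.
- by apply/measurable_EFinP; exact: measurable_normc_powR.
- by apply/measurable_EFinP; exact: measurable_normc_powR.
- by move=> x Ox; rewrite lee_fin ge0_ler_powR ?nnegrE ?normc_ge0 ?fg// ltW.
Qed.

Lemma eq_Lpnorm f g : (forall x, Omega x -> f x = g x) -> Lpnorm mu p f = Lpnorm mu p g.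
Proof.
move=> fg; rewrite /Lpnorm; congr (_ `^ _)%E; apply: eq_integral => x /set_mem Ox.
by rewrite fg.
Qed.

Lemma Lpnorm_le_int f (K : R) : 0 <= K ->
  (\int[mu]_(x in Om) (normc (f x) `^ p)%:E <= (K `^ p)%:E)%E -> (Lpnorm mu p f <= K%:E)%E.
Proof.
move=> K0 H.
have -> : K%:E = ((K `^ p)%:E `^ p^-1)%E.
  by rewrite poweR_EFin -powRrM divff ?gt_eqF// powRr1.
by apply: lee_poweR; [rewrite invr_ge0 ltW|exact: int_ge0|].
Qed.

Lemma Lpnorm_le_bound f (K : R) : measC f -> 0 <= K ->
  (forall x, Omega x -> normc (f x) <= K) -> (Lpnorm mu p f <= K%:E)%E.
Proof.
move=> mf K0 fK; apply: Lpnorm_le_int => //.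
have -> : (K `^ p)%:E = (\int[mu]_(x in Om) (cst (K `^ p)%:E x))%E.
  rewrite integral_cst; last exact: measurable_Omega.
  by rewrite (mu_Omega mu_leb) mule1.
apply: ge0_le_integral => //; first exact: measurable_Omega.
- by move=> x _; rewrite lee_fin powR_ge0.
- by apply/measurable_EFinP; exact: measurable_normc_powR.
- by move=> x Ox; rewrite lee_fin ge0_ler_powR ?nnegrE ?normc_ge0 ?fK// ltW.
Qed.

Lemma Lpnorm_cont_fin f : ccontinuous f -> (Lpnorm mu p f < +oo)%E.
Proof.
move=> cf; have [K K0 HK] := cube_bounded cf.
apply: (@le_lt_trans _ _ K%:E); last exact: ltry.
by apply: Lpnorm_le_bound => //; [exact: ccont_meas|move=> x /Omega_cube/HK].
Qed.

Lemma inLp_cont f : ccontinuous f -> inLp mu p f.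
Proof. by move=> cf; split; [exact: ccont_meas|exact: Lpnorm_cont_fin]. Qed.

Let restr f : Pt -> R := (fun x => normc (f x)) \_ Om.

(** Extending the modulus by 0 outside the cube gives a norm over the whole space, to which
    Minkowski's inequality applies. *)
Let Lpnorm_Lnorm f : Lpnorm mu p f = ('N[mu]_p%:E[EFin \o restr f])%E.
Proof.
rewrite unlock /Lpnorm [in LHS]integral_mkcond; congr (_ `^ _)%E.
apply: eq_integral => x _; rewrite /restr /= !patchE; case: ifP => _ /=.
  by rewrite ger0_norm ?normc_ge0.
by rewrite normr0 powR0// gt_eqF.
Qed.

(** Stated by domination of moduli rather than for [f + g], so that one of the terms may be a
    truncated modulus. *)
Lemma Lpnorm_triangle f g w : measC f -> measC g -> measC w ->
  (forall x, Omega x -> normc (w x) <= normc (f x) + normc (g x)) ->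
  (Lpnorm mu p w <= Lpnorm mu p f + Lpnorm mu p g)%E.
Proof.
move=> mf mg mw H; have mO := @measurable_Omega R n.
pose s : CFun := fun x => (normc (f x) + normc (g x))%:C.
have ms : measC s.
  by split => //=; apply: measurable_funD; exact: measurable_normc.
apply: (@le_trans _ _ (Lpnorm mu p s)).
  apply: Lpnorm_mono => // x Ox.
  by rewrite normcC ger0_norm ?addr_ge0 ?normc_ge0// H.
rewrite !Lpnorm_Lnorm.
have mr u : measC u -> measurable_fun [set: Pt] (restr u).
  by move=> mu'; apply/(measurable_restrictT _ mO); exact: measurable_normc.
have := minkowski_EFin mu (mr _ mf) (mr _ mg) p1.
congr (_ <= _)%E; apply: eq_Lnorm => x /=; congr EFin.
rewrite /restr !patchE; case: ifP => _; last by rewrite addr0.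
by rewrite normcC ger0_norm ?addr_ge0 ?normc_ge0.
Qed.

Lemma LpnormZ (a : R[i]) f : measC f ->
  Lpnorm mu p (fun x => a * f x) = ((normc a)%:E * Lpnorm mu p f)%E.
Proof.
move=> mf; rewrite /Lpnorm.
under eq_integral do rewrite normc_mul powRM ?normc_ge0// EFinM.
rewrite ge0_integralZl_EFin ?powR_ge0//; last 3 first.
- exact: measurable_Omega.
- by move=> x _; rewrite lee_fin powR_ge0.
- by apply/measurable_EFinP; exact: measurable_normc_powR.
rewrite poweRM ?lee_fin ?powR_ge0//; congr (_ * _)%E.
by rewrite poweR_EFin -powRrM divff ?gt_eqF// powRr1// normc_ge0.
Qed.

Lemma Lpnorm_sum (s : seq nat) (c : nat -> R[i]) (Y : nat -> CFun) (K : R) :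
  0 <= K -> (forall k, normc (c k) <= K) -> (forall k, ccontinuous (Y k)) ->
  (Lpnorm mu p (fun x => \sum_(k <- s) c k * Y k x)%R <=
   \sum_(k <- s) K%:E * Lpnorm mu p (Y k))%E.
Proof.
move=> K0 cK cY; elim: s => [|k s IH].
  rewrite big_nil; apply: Lpnorm_le_bound => //.
    by under eq_fun do rewrite big_nil; exact: (ccont_meas (@ccont_cst R n 0)).
  by move=> x _; rewrite big_nil normcR0.
have cs t : ccontinuous (fun x => \sum_(k <- t) c k * Y k x).
  by apply: ccont_sum => l; exact: (ccontZ _ (cY l)).
rewrite big_cons; apply: le_trans (leeD _ IH); last first.
  apply: (@le_trans _ _ ((normc (c k))%:E * Lpnorm mu p (Y k))%E); last first.
    by apply: lee_wpmul2r; rewrite ?Lpnorm_ge0// lee_fin.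
  by rewrite -LpnormZ//; exact: (ccont_meas (cY k)).
apply: Lpnorm_triangle.
- exact: (ccont_meas (ccontZ _ (cY k))).
- exact: (ccont_meas (cs s)).
- exact: (ccont_meas (cs (k :: s))).
- by move=> x _; rewrite big_cons ler_normcD.
Qed.

Lemma integral_rcont (F : Pt -> R) : rcont F ->
  (\int[mu]_(x in Om) (F x)%:E = (\int[mu]_(x in Om) F x)%R%:E)%E.
Proof.
move=> cF; have iF := rcont_integrable mu_leb cF.
by rewrite /Rintegral fineK//; exact: (integrable_fin_num (@measurable_Omega R n) iF).
Qed.

Lemma rcont_min (F : Pt -> R) (K : R) : rcont F -> rcont (fun x => Order.min (F x) K).
Proof.
move=> /rcontP cF; apply/rcontP => x e e0; have [d d0 H] := cF x e e0.
exists d => // y /H; apply: le_lt_trans.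
by rewrite /Order.min; do 2 case: ifP => ?; rewrite !ler_norml; do ?[apply/andP; split];
  have := ler_norm (F y - F x); have := ler_norm (F x - F y); rewrite (distrC (F x)); lra.
Qed.

(* Truncating at a bound [K] of the limit turns smallness in L^2 into
   smallness in L^p for every finite [p]. *)
Lemma truncation_Lp (a K : R) : 0 < a -> 0 < K -> exists2 e : R, 0 < e &
  forall f, ccontinuous f -> \int[mu]_(x in Om) (normc (f x) ^+ 2) <= e ->
    (Lpnorm mu p (fun x => (Order.min (normc (f x)) K)%:C) <= (2 * a)%:E)%E.
Proof.
move=> a0 K0; have a20 : 0 < a ^+ 2 by rewrite exprn_gt0.
have Kp0 := powR_gt0 p K0; have ap0 := powR_gt0 p a0.
(* Where [|f| <= a] the truncated power is at most [a^p]; elsewhere it is at most [K^p <= c |f|^2].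
   With [e = a^p / c] the total is [2 a^p <= (2 a)^p], as [p >= 1]. *)
pose c := K `^ p / a ^+ 2; have c0 : 0 < c by rewrite divr_gt0.
exists (a `^ p / c) => [|f cf]; first by rewrite divr_gt0.
rewrite ler_pdivlMr// => H.
have rf := rcont_normc cf; have rf2 := rcont_normc2 cf.
have rm := ccont_meas (ccont_real (rcont_min (K := K) rf)).
apply: Lpnorm_le_int; first by rewrite mulr_ge0// ltW.
apply: (@le_trans _ _ (\int[mu]_(x in Om) (a `^ p + c * normc (f x) ^+ 2)%:E)%E).
  have rr : rcont (fun x => a `^ p + c * normc (f x) ^+ 2).
    exact (rcontD (@rcont_cst R n (a `^ p)) (rcontM (@rcont_cst R n c) rf2)).
  apply: ge0_le_integral => //; first exact: measurable_Omega.
  - by move=> x _; rewrite lee_fin powR_ge0.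
  - by apply/measurable_EFinP; exact: measurable_normc_powR.
  - apply/measurable_EFinP; exact: (measurable_funS measurableT _ (rcont_measurable rr)).
  - move=> x _; rewrite lee_fin normcC.
    have m0 : 0 <= Order.min (normc (f x)) K by rewrite le_min normc_ge0 ltW.
    rewrite ger0_norm//; have [fa|af] := leP (normc (f x)) a.
      apply: (@le_trans _ _ (a `^ p)); last first.
        by rewrite lerDl; exact: (mulr_ge0 (ltW c0) (exprn_ge0 _ (normc_ge0 _))).
      rewrite ge0_ler_powR ?nnegrE ?(ltW p0) ?(ltW a0)//.
      by rewrite ge_min fa.
    apply: (@le_trans _ _ (0 + c * normc (f x) ^+ 2)); last by rewrite lerD2r ltW.
    rewrite add0r; apply: (@le_trans _ _ (K `^ p)).
      rewrite ge0_ler_powR ?nnegrE ?(ltW p0) ?(ltW K0)//.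
      by rewrite ge_min lexx orbT.
    rewrite /c mulrAC -mulrA ler_peMr ?(ltW Kp0)// ler_pdivlMr// mul1r.
    by rewrite ler_sqr ?nnegrE ?normc_ge0 ?(ltW a0)// ltW.
have mO := @measurable_Omega R n.
have i1 := rcont_integrable mu_leb (@rcont_cst R n (a `^ p)).
have i2 := rcont_integrable mu_leb (rcontM (@rcont_cst R n c) rf2).
rewrite integral_rcont; last exact (rcontD (@rcont_cst R n (a `^ p)) (rcontM (@rcont_cst R n c) rf2)).
rewrite lee_fin (RintegralD mO i1 i2) (Rintegral_Omega_cst mu_leb) RintegralZl//; last exact: rcont_integrable.
apply: (@le_trans _ _ (2 * a `^ p)).
  by rewrite mulrDl mul1r lerD2l mulrC.
rewrite powRM ?(ltW a0)// ler_pM2r//.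
by rewrite -{1}[2]powRr1// ler_powR// ler1n.
Qed.

(** [D N] is [D M] plus a block of the series. Letting [M] grow, truncation removes [D M], which is
    small in L^2, and [D N] is bounded by the tail of a convergent series of L^p norms. *)
Lemma Lp_cvg0 (D Y : nat -> CFun) (c : nat -> R[i]) (K : R) :
  0 <= K -> (forall k, normc (c k) <= K) -> (forall k, ccontinuous (Y k)) ->
  (forall N, ccontinuous (D N)) ->
  (forall N M x, (N <= M)%N -> Omega x -> D N x = D M x + \sum_(N <= k < M) c k * Y k x) ->
  (forall e, 0 < e -> exists N0 : nat, forall N, (N0 <= N)%N ->
    \int[mu]_(x in Om) (normc (D N x) ^+ 2) <= e) ->
  (\sum_(k <oo) Lpnorm mu p (Y k) < +oo)%E ->
  (fun N => Lpnorm mu p (D N)) @ \oo --> 0%E.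
Proof.
move=> K0 cK cY cD DE D2 Ysum.
have Y0 k : (0 <= K%:E * Lpnorm mu p (Y k))%E by rewrite mule_ge0 ?lee_fin// Lpnorm_ge0.
have bound N : (Lpnorm mu p (D N) <= \sum_(N <= k <oo) K%:E * Lpnorm mu p (Y k))%E.
  apply/lee_addgt0Pr => e e0.
  have [B B0 HB] := cube_bounded (cD N).
  have e20 : 0 < e / 2 by rewrite divr_gt0.
  have B10 : 0 < B + 1 by lra.
  have [d d0 Hd] := truncation_Lp e20 B10.
  have [N0 HN0] := D2 d d0.
  pose M := maxn N N0; have NM : (N <= M)%N by rewrite leq_maxl.
  have HM := Hd (D M) (cD M) (HN0 M (leq_maxr _ _)).
  rewrite mulrCA divff// mulr1 in HM.
  have cS : ccontinuous (fun x => \sum_(N <= k < M) c k * Y k x).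
    by apply: ccont_sum => l; exact: (ccontZ _ (cY l)).
  rewrite addeC; apply: le_trans (leeD HM (lexx _)).
  pose tr : CFun := fun x => (Order.min (normc (D M x)) (B + 1))%:C.
  pose tl : CFun := fun x => \sum_(N <= k < M) c k * Y k x.
  apply: (@le_trans _ _ (Lpnorm mu p tr + Lpnorm mu p tl)%E).
    apply: Lpnorm_triangle; [|exact: ccont_meas..|].
      exact: (ccont_meas (ccont_real (rcont_min (K := B + 1) (rcont_normc (cD M))))).
    move=> x Ox; rewrite normcC ger0_norm; last by rewrite le_min normc_ge0 ltW.
    (* Either the truncation is inactive and the triangle inequality applies, or its value [B + 1]
       already exceeds [|D N|]. *)
    rewrite minEle; case: ifP => _; first by rewrite (DE N M x NM Ox) ler_normcD.
    rewrite -[leLHS]addr0 lerD ?normc_ge0//.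
    by apply: le_trans (HB x (Omega_cube Ox)) _; lra.
  apply: leeD => //; apply: le_trans (Lpnorm_sum _ K0 cK cY) _.
  by apply: nneseries_lim_ge.
apply: (@squeeze_cvge _ _ _ _ (fun=> 0%E) _ (fun N => \sum_(N <= k <oo) K%:E * Lpnorm mu p (Y k))%E).
- by apply: nearW => N; rewrite Lpnorm_ge0 bound.
- exact: cvg_cst.
- apply: nneseries_tail_cvg => //.
  rewrite nneseriesZl; last by move=> k _; exact: Lpnorm_ge0.
  by rewrite lte_mul_pinfty// ?lee_fin.
Qed.

End LpNorm.

(** The inclusion of l^r in l^1: every term is at most [s^{1/r}], so [v = v^{1-r} v^r] is at most a
    constant times [v^r]. *)
Lemma nneseries_powR_lty (R : realType) (v : nat -> R) (r : R) :
  0 < r <= 1 -> (forall k, 0 <= v k) ->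
  (\sum_(k <oo) (v k)%:E `^ r < +oo)%E -> (\sum_(k <oo) (v k)%:E < +oo)%E.
Proof.
move=> /andP[r0 r1] v0; set s := (\sum_(k <oo) _)%E => sfin.
have t0 k : (0 <= (v k)%:E `^ r)%E by exact: poweR_ge0.
have s0 : (0 <= s)%E by exact: nneseries_ge0.
have sE : s = (fine s)%:E by rewrite fineK// ge0_fin_numE.
have vs k : v k `^ r <= fine s.
  rewrite -lee_fin -sE -poweR_EFin.
  have H := @nneseries_lim_ge R (fun k => (v k)%:E `^ r)%E xpredT 0 k.+1 (fun k _ _ => t0 k).
  apply: le_trans H.
  rewrite big_nat_recr//=; apply: leeDr; apply: sume_ge0 => i _; exact: t0.
pose c := (fine s `^ r^-1) `^ (1 - r).
have vc k : v k <= c * v k `^ r.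
  rewrite -{1}[v k]powRr1// -{1}(subrK r 1) powRD; last by rewrite subrK oner_eq0.
  rewrite ler_wpM2r ?powR_ge0// ge0_ler_powR ?nnegrE ?powR_ge0 ?subr_ge0//.
  have -> : v k = (v k `^ r) `^ r^-1 by rewrite -powRrM divff ?gt_eqF// powRr1.
  by rewrite ge0_ler_powR ?nnegrE ?powR_ge0 ?fine_ge0 ?invr_ge0// ltW.
apply: (@le_lt_trans _ _ (\sum_(k <oo) c%:E * (v k)%:E `^ r)%E).
  apply: lee_nneseries => [k _ _|k _]; first by rewrite lee_fin.
  by rewrite poweR_EFin -EFinM lee_fin.
rewrite nneseriesZl//.
by rewrite -/s lte_mul_pinfty// ?lee_fin ?powR_ge0.
Qed.

(** * The coefficient functionals on L^p *)

Section Functionals.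
Variables (R : realType) (n : nat) (h : n.-tuple R).
Hypothesis h_pos : forall j : 'I_n, 0 < tnth h j.
Local Notation Pt := (Pt R n).
Local Notation CFun := (CFun R n).
Local Notation Om := (@Omega R n).
Local Notation Zn := (n.-tuple int).
Variable mu : {measure set Pt -> \bar R}.
Hypothesis mu_leb : is_lebesgue mu.
Variable p : R.
Hypothesis p1 : 1 <= p.
Variable B : R.
Hypothesis B0 : 0 < B.
Hypothesis HB : forall xi (x : Pt), cube x -> normc (wexp h xi x) <= B.
Implicit Types (f g : CFun).

Let p0 : 0 < p. Proof. exact: lt_le_trans ltr01 p1. Qed.

Lemma ler_1DpowR (t : R) : 0 <= t -> t <= 1 + t `^ p.
Proof.
move=> t0; have [t1|/ltW t1] := leP t 1.
  by apply: le_trans t1 _; rewrite lerDl powR_ge0.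
by apply: (@le_trans _ _ (t `^ p)); rewrite ?lerDr// -{1}[t]powRr1// ler_powR.
Qed.

Lemma Lp_int_fin f : (Lpnorm mu p f < +oo)%E ->
  (\int[mu]_(x in Om) (normc (f x) `^ p)%:E < +oo)%E.
Proof.
rewrite /Lpnorm; set I := (\int[mu]_(x in _) _)%E => H.
rewrite ltey; apply/eqP => IE; move: H; rewrite IE poweRyr ?ltxx//.
by rewrite invr_neq0// gt_eqF.
Qed.

(** A substitute for Hölder's inequality on a space of mass 1: on the unit ball of L^p it bounds the
    L^1 norm by 2 for every [p]. *)
Lemma L1_le f : measC f ->
  (\int[mu]_(x in Om) (normc (f x))%:E <=
   1 + \int[mu]_(x in Om) (normc (f x) `^ p)%:E)%E.
Proof.
move=> mf; have mO := @measurable_Omega R n.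
have -> : 1%E = (\int[mu]_(x in Om) (cst 1%E x))%E.
  by rewrite integral_cst// (mu_Omega mu_leb) mule1.
have mp := measurable_normc_powR p mf.
rewrite -ge0_integralD//; last 2 first.
- by move=> x _; rewrite lee_fin powR_ge0.
- exact/measurable_EFinP.
apply: ge0_le_integral => //.
- by move=> x _; rewrite lee_fin normc_ge0.
- by apply/measurable_EFinP; exact: measurable_normc.
- by apply: emeasurable_funD => //; exact/measurable_EFinP.
- by move=> x _; rewrite /= -EFinD lee_fin ler_1DpowR ?normc_ge0.
Qed.

Lemma meas_mul f xi : measC f -> measC (fun x => f x * wexp h xi x).
Proof.
move=> [mr mi]; have [wr wi] := ccont_meas (@ccont_wexp R n h xi).
split.
  by under eq_fun do rewrite ReM; apply: measurable_funB; exact: measurable_funM.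
by under eq_fun do rewrite ImM; apply: measurable_funD; exact: measurable_funM.
Qed.

Lemma int_mul_le f xi : measC f ->
  (\int[mu]_(x in Om) (normc (f x * wexp h xi x))%:E <=
   B%:E * \int[mu]_(x in Om) (normc (f x))%:E)%E.
Proof.
move=> mf; have mO := @measurable_Omega R n.
have mn : measurable_fun Om (EFin \o (fun x => normc (f x))).
  by apply/measurable_EFinP; exact: measurable_normc.
rewrite -ge0_integralZl_EFin ?(ltW B0)//; last first.
  by move=> x _; rewrite lee_fin normc_ge0.
apply: ge0_le_integral => //.
- by move=> x _; rewrite lee_fin normc_ge0.
- by apply/measurable_EFinP; apply: measurable_normc; exact: meas_mul.
- by apply: measurable_funeM.
- move=> x Ox; rewrite -EFinM lee_fin normc_mul mulrC ler_wpM2r ?normc_ge0//.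
  exact: HB (Omega_cube Ox).
Qed.

Lemma mul_integrable f xi : inLp mu p f -> cintegrable mu (fun x => f x * wexp h xi x).
Proof.
move=> [mf Lf]; have mO := @measurable_Omega R n.
have [mr mi] := meas_mul xi mf.
have fin : (\int[mu]_(x in Om) (normc (f x * wexp h xi x))%:E < +oo)%E.
  apply: le_lt_trans (int_mul_le xi mf) _.
  rewrite lte_mul_pinfty ?lee_fin ?(ltW B0)//.
  apply: le_lt_trans (L1_le mf) _; rewrite lte_add_pinfty ?ltry//.
  exact: Lp_int_fin.
have key (F : Pt -> R) : measurable_fun Om F ->
    (forall x, `|F x| <= normc (f x * wexp h xi x)) -> mu.-integrable Om (EFin \o F).
  move=> mF FN; apply/integrableP; split; first exact/measurable_EFinP.
  apply: le_lt_trans fin; apply: ge0_le_integral => //.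
  - by apply: measurableT_comp => //; exact/measurable_EFinP.
  - by apply/measurable_EFinP; apply: measurable_normc; exact: meas_mul.
  - by move=> x _; rewrite /= lee_fin.
by split; apply: key => // x; [exact: normc_Re|exact: normc_Im].
Qed.

Definition xs (k : nat) (f : CFun) : R[i] := hatk h mu f k.

Lemma xs_lin k (a : R[i]) f g : inLp mu p f -> inLp mu p g ->
  xs k (fun x => a * f x + g x) = a * xs k f + xs k g.
Proof.
move=> Lf Lg; rewrite /xs /hatk /at_freq; case: pickle_inv => [xi|]; last by rewrite mulr0 addr0.
have If := mul_integrable xi Lf; have Ig := mul_integrable xi Lg.
rewrite /hat -CintZ// -CintD//; last exact: cintegrableZ.
by apply: eq_Cint => x _; rewrite mulrDl mulrA.
Qed.

(** The 4 is 2 from [normc_Cint] times [1 + 1] from [L1_le]; [B] bounds [w_xi]. *)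
Lemma xs_unit k f : inLp mu p f -> (Lpnorm mu p f <= 1)%E -> normc (xs k f) <= 4 * B.
Proof.
move=> Lf f1; rewrite /xs /hatk /at_freq; case: pickle_inv => [xi|]; last first.
  by rewrite normcR0 mulr_ge0// ltW.
rewrite -lee_fin; apply: le_trans (normc_Cint (mul_integrable xi Lf)) _.
have -> : (4 * B)%:E = (2%:E * (B%:E * 2%:E))%E by rewrite -!EFinM; congr EFin; ring.
apply: lee_wpmul2l; first by rewrite lee_fin.
apply: le_trans (int_mul_le xi Lf.1) _; apply: lee_wpmul2l; first by rewrite lee_fin ltW.
apply: le_trans (L1_le Lf.1) _.
have -> : 2%:E = (1 + 1)%E :> \bar R by rewrite -EFinD.
apply: leeD => //.
have := lee_poweR (ltW p0) (Lpnorm_ge0 mu p f) f1.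
rewrite /Lpnorm -poweRrM mulVf ?gt_eqF// poweRe1 ?poweR1r//.
by apply: integral_ge0 => x _; rewrite lee_fin powR_ge0.
Qed.

Lemma dualnorm_xs k : (dualnorm mu p (xs k) <= (4 * B)%:E)%E.
Proof.
apply: ge_ereal_sup => _ [f [Lf f1] <-]; rewrite lee_fin; exact: xs_unit.
Qed.

Lemma dualnorm_ge0 k : (0 <= dualnorm mu p (xs k))%E.
Proof.
have c0 := @ccont_cst R n 0.
apply: (@le_trans _ _ (normc (xs k (fun=> 0)))%:E); first by rewrite lee_fin normc_ge0.
apply: ereal_sup_ubound; exists (fun=> 0) => //; split; first exact: (inLp_cont mu_leb p1 c0).
apply: (Lpnorm_le_bound mu_leb p1 (ccont_meas c0)) => //.
by move=> x _; rewrite normcR0.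
Qed.

Lemma inLpZ (a : R[i]) f : inLp mu p f -> inLp mu p (fun x => a * f x).
Proof.
move=> [[mr mi] Lf]; split.
  split.
    by under eq_fun do rewrite ReM; apply: measurable_funB; apply: measurable_funM.
  by under eq_fun do rewrite ImM; apply: measurable_funD; apply: measurable_funM.
by rewrite LpnormZ// lte_mul_pinfty// lee_fin normc_ge0.
Qed.

Lemma xs_bound k f : inLp mu p f ->
  ((normc (xs k f))%:E <= (4 * B)%:E * Lpnorm mu p f)%E.
Proof.
move=> Lf.
have B40 : 0 < 4 * B by rewrite mulr_gt0.
have LE : Lpnorm mu p f = (fine (Lpnorm mu p f))%:E.
  by rewrite fineK// ge0_fin_numE ?Lpnorm_ge0//; case: Lf.
have L0 : 0 <= fine (Lpnorm mu p f) by rewrite fine_ge0// Lpnorm_ge0.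
rewrite LE -EFinM lee_fin; set L := fine _ in LE L0 *.
apply/ler_addgt0Pr => e e0.
(* The norm of [f] may be 0, so [f] is scaled by a slightly larger number; the excess costs exactly
   [e]. *)
pose t := L + e / (4 * B); have t0 : 0 < t by rewrite ltr_wpDl// divr_gt0.
have Ltle1 : (Lpnorm mu p (fun x => (t^-1)%:C * f x)%R <= 1)%E.
  rewrite (LpnormZ mu p1 _ Lf.1) normcC gtr0_norm ?invr_gt0// LE -EFinM lee_fin mulrC ler_pdivrMr// mul1r.
  by rewrite lerDl ltW// divr_gt0.
have := xs_unit k (inLpZ (t^-1)%:C Lf) Ltle1.
have -> : xs k (fun x => (t^-1)%:C * f x) = (t^-1)%:C * xs k f.
  have c0 := inLp_cont mu_leb p1 (@ccont_cst R n 0).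
  have xs0 : xs k (fun=> 0) = 0.
    have := xs_lin k 1 c0 c0; under eq_fun do rewrite mulr0 addr0.
    by rewrite mul1r -[LHS]addr0 => /addrI.
  have := xs_lin k (t^-1)%:C Lf c0; under eq_fun do rewrite addr0.
  by rewrite xs0 addr0.
rewrite normc_mul normcC gtr0_norm ?invr_gt0// mulrC ler_pdivrMr// => H.
apply: le_trans H _; rewrite /t mulrDr lerD2l mulrC divfK// gt_eqF//.
Qed.

Lemma Lp_dual_xs k : Lp_dual mu p (xs k).
Proof.
split=> [a f g Lf Lg|]; first exact: xs_lin.
by exists (4 * B) => f; exact: xs_bound.
Qed.

End Functionals.

(** Positions that carry no frequency contribute 0, and [pickle] is injective, so the series is a
    reindexing of the unordered sum. *)
Lemma sum_at_freq (R : realType) (n : nat) (G : n.-tuple int -> \bar R) :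
  (forall xi, 0 <= G xi)%E ->
  (\sum_(k <oo) at_freq 0%E G k = \esum_(xi in [set: n.-tuple int]) G xi)%E.
Proof.
move=> G0; have a0 k : (0 <= at_freq 0%E G k)%E.
  by rewrite /at_freq; case: pickle_inv.
rewrite nneseries_esum//.
have -> : (\esum_(k in [set x | xpredT x]) at_freq 0%E G k =
    \esum_(k in range (@pickle (n.-tuple int))) at_freq 0%E G k)%E.
  rewrite [RHS]esum_mkcond; rewrite (_ : [set x | xpredT x] = [set: nat]); last first.
    by apply/seteqP; split.
  apply: eq_esum => k _; case: ifPn => // /negP kN; rewrite /at_freq.
  case E : pickle_inv => [xi|]//; exfalso; apply: kN; apply/mem_set; exists xi => //.
  by have := @pickle_invK (n.-tuple int) k; rewrite E.
rewrite (@reindex_esum _ _ _ [set: n.-tuple int] _ (@pickle (n.-tuple int))).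
  by apply: eq_esum => xi _; rewrite /at_freq pickleK_inv.
split.
- by move=> xi _; exists xi.
- by move=> xi eta _ _; exact: (pcan_inj pickleK).
- by move=> k [xi _ <-]; exists xi.
Qed.

(** * The nuclear representation and the bound on its quasi-norm *)

Theorem theorem4p3 (R : realType) (n : nat) (h : n.-tuple R)
    (h_pos : forall j : 'I_n, 0 < tnth h j)
    (mu : {measure set (n.-tuple R) -> \bar R})
    (mu_leb : is_lebesgue mu) :
  exists2 C : R, 0 < C &
  forall (r p2 : R) (A : CFun R n -> CFun R n),
    0 < r <= 1 -> 1 <= p2 ->
    (forall f, CinfLh h f -> CinfLh h (A f)) ->
    linear_on_Cinf h A ->
    cont_on_Cinf mu h A ->
    (\esum_(xi in [set: n.-tuple int]) (Lpnorm mu p2 (symbol h A xi) `^ r) < +oo)%E ->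
    forall p1 : R, 1 <= p1 ->
      r_nuclear mu h r p1 p2 A /\
      (nuclear_qnorm_pow mu h r p1 p2 A <=
         (C `^ r)%:E * \esum_(xi in [set: n.-tuple int]) (Lpnorm mu p2 (symbol h A xi) `^ r))%E.
Proof.
have [B B0 HB] := wexp_bounded h; have [U U0 HU] := uexp_bounded h.
(* [4 * B] bounds the dual norms and [U] the eigenfunctions; both come from [h] alone and are fixed
   before [r], the exponents and [A]. *)
exists (4 * B * U); first by rewrite !mulr_gt0.
move=> r p2 A r01 p21 AC Alin Acont sumfin p1 p11.
have /andP[r0 r1] := r01.
set sg := fun xi => (Lpnorm mu p2 (symbol h A xi) `^ r)%E.
have sg0 xi : (0 <= sg xi)%E by exact: poweR_ge0.
pose ys k := A (us h k).
have cys k : ccontinuous (ys k) by exact: ccont_Aus.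
have ysU k : (Lpnorm mu p2 (ys k) <= at_freq 0 (fun xi => U%:E * Lpnorm mu p2 (symbol h A xi)) k)%E.
  rewrite /ys /us /at_freq; case E : pickle_inv => [xi|]; last first.
    (* A position without frequency carries the zero function, which [A] maps to 0 on the cube. *)
    rewrite (eq_Lpnorm _ _ (g := fun=> 0)); last by move=> x Ox; exact: (A_zero Alin Ox).
    apply: (Lpnorm_le_bound mu_leb p21 (ccont_meas (@ccont_cst R n 0))) => //.
    by move=> x _; rewrite normcR0.
  have cA := smooth_cont (AC _ (CinfLh_Exp h_pos xi)).1.
  have sE x : symbol h A xi x = wexp h xi x * A (Exp (uexp h xi)) x.
    rewrite /symbol u_xiE//; congr (_ * _); have uw := uexp_wexp h xi x.
    have u0 : Exp (uexp h xi) x != 0.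
      by apply/eqP => u0; move: uw; rewrite u0 mul0r => /esym/eqP; rewrite oner_eq0.
    by apply: (mulfI u0); rewrite uw mulfV.
  have csy : ccontinuous (symbol h A xi).
    by rewrite (funext sE); exact: (ccontM (@ccont_wexp R n h xi) cA).
  have -> : U = normc U%:C by rewrite normcC gtr0_norm.
  rewrite -LpnormZ//; last exact: ccont_meas.
  apply: Lpnorm_mono => //; [exact: ccont_meas|exact: (ccont_meas (ccontZ _ csy))|].
  move=> x Ox; rewrite sE !normc_mul normcC gtr0_norm//.
  (* Since [u_xi w_xi = 1], [|A u_xi| = |u_xi| |w_xi A u_xi|], and the last factor is the modulus of
     the symbol. *)
  have := congr1 (@ComplexField.Normc.normc R) (uexp_wexp h xi x).
  rewrite normc_mul => nuw; rewrite mulrA ler_peMl ?normc_ge0//.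
  have -> : 1 = normc (Exp (uexp h xi) x) * normc (wexp h xi x).
    by rewrite nuw; exact: (esym (etrans (normcC 1) (normr1 _))).
  by rewrite ler_wpM2r ?normc_ge0// HU//; exact: Omega_cube.
have term k : ((dualnorm mu p1 (xs h mu k) * Lpnorm mu p2 (ys k)) `^ r <=
    at_freq 0 (fun xi => ((4 * B * U) `^ r)%:E * sg xi) k)%E.
  have d0 := dualnorm_ge0 h mu_leb p11 k.
  have L0 := Lpnorm_ge0 mu p2 (ys k).
  have := ysU k; rewrite /at_freq; case E : pickle_inv => [xi|] yU.
    rewrite /sg -poweR_EFin -poweRM ?lee_fin ?mulr_ge0 ?(ltW B0) ?(ltW U0) ?Lpnorm_ge0//.
    apply: lee_poweR; [exact: ltW|exact: mule_ge0|].
    rewrite EFinM -muleA; apply: lee_pmul => //.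
    exact: dualnorm_xs.
  have -> : Lpnorm mu p2 (ys k) = 0%E by apply/eqP; rewrite eq_le yU L0.
  by rewrite mule0 poweR_EFin powR0// gt_eqF.
have t0 k : (0 <= (dualnorm mu p1 (xs h mu k) * Lpnorm mu p2 (ys k)) `^ r)%E by exact: poweR_ge0.
have le_sum : (\sum_(k <oo) ((dualnorm mu p1 (xs h mu k) * Lpnorm mu p2 (ys k)) `^ r) <=
    ((4 * B * U) `^ r)%:E * \esum_(xi in [set: n.-tuple int]) sg xi)%E.
  apply: (@le_trans _ _ (\sum_(k <oo) ((4 * B * U) `^ r)%:E * at_freq 0 sg k)%E).
    apply: lee_nneseries => [k _ _|k _]; first exact: t0.
    by apply: le_trans (term k) _; rewrite /at_freq; case: pickle_inv => //; rewrite mule0.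
  rewrite nneseriesZl; first by rewrite sum_at_freq.
  by move=> k _; rewrite /at_freq; case: pickle_inv.
have fin_sum : (\sum_(k <oo) ((dualnorm mu p1 (xs h mu k) * Lpnorm mu p2 (ys k)) `^ r) < +oo)%E.
  by apply: le_lt_trans le_sum _; rewrite lte_mul_pinfty// lee_fin powR_ge0.
(* Absolute convergence in L^p2, where [r <= 1] enters. *)
have ys_fin : (\sum_(k <oo) Lpnorm mu p2 (ys k) < +oo)%E.
  have yE k : Lpnorm mu p2 (ys k) = (fine (Lpnorm mu p2 (ys k)))%:E.
    by rewrite fineK// ge0_fin_numE ?Lpnorm_ge0//; exact: Lpnorm_cont_fin.
  under eq_eseriesr do rewrite yE.
  apply: (@nneseries_powR_lty _ _ r) => //; first by move=> k; rewrite fine_ge0// Lpnorm_ge0.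
  under eq_eseriesr do rewrite -yE.
  apply: (@le_lt_trans _ _ (\sum_(k <oo) (U `^ r)%:E * at_freq 0 sg k)%E).
    apply: lee_nneseries => [k _ _|k _]; first exact: poweR_ge0.
    apply: le_trans (lee_poweR (ltW r0) (Lpnorm_ge0 _ _ _) (ysU k)) _.
    rewrite /at_freq; case: pickle_inv => [xi|]; last by rewrite mule0 poweR_EFin powR0// gt_eqF.
    by rewrite poweRM ?lee_fin ?(ltW U0) ?Lpnorm_ge0// poweR_EFin.
  rewrite nneseriesZl; last by move=> k _; rewrite /at_freq; case: pickle_inv.
  by rewrite sum_at_freq// lte_mul_pinfty// lee_fin powR_ge0.
have rep : nuclear_rep mu h r p1 p2 A (xs h mu) ys.
  split=> //.
  - by move=> k; exact: (Lp_dual_xs mu_leb p11 B0 HB).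
  - by move=> k; exact: inLp_cont.
  move=> f Cf.
  have Lf := inLp_cont mu_leb p11 (smooth_cont Cf.1).
  have [K K0 HK] : exists2 K : R, 0 <= K & forall k, normc (xs h mu k f) <= K.
    have Lfin : Lpnorm mu p1 f = (fine (Lpnorm mu p1 f))%:E.
      by rewrite fineK// ge0_fin_numE ?Lpnorm_ge0//; case: Lf.
    exists (4 * B * fine (Lpnorm mu p1 f)) => [|k].
      by rewrite mulr_ge0 ?fine_ge0 ?Lpnorm_ge0// mulr_ge0// ltW.
    by rewrite -lee_fin EFinM -Lfin; exact: (xs_bound mu_leb p11 B0 HB).
  apply: (@Lp_cvg0 _ _ mu mu_leb p2 p21 (fun N => Dn h mu A f N) ys (fun k => xs h mu k f) K) => //.
  - by move=> N; exact: ccont_Dn.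
  - move=> N M' x NM Ox; rewrite /Dn -!(big_mkord xpredT (fun k => hatk h mu f k * A (us h k) x)).
    by rewrite [X in _ = _ - X + _](big_cat_nat (leq0n N) NM) /= opprD addrA subrK.
  - by move=> e; exact: A_L2_conv.
split; first by exists (xs h mu), ys.
apply: le_trans le_sum; apply: ereal_inf_lbound.
by exists (xs h mu), ys.
Qed.
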